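(* Suppose that the function $\varphi(x)=\sum_{i\in I}[f_i^L(x)+f_i^U(x)]$ is bounded from below on $S$. Then there exist an almost regular $\mathcal{E}$-Pareto solution $z$ of (RMP) and $\lambda=(\lambda_1,\ldots,\lambda_p)\in\mathbb{R}^p_+$ such that $$0\in\sum_{i\in I}[\partial f_i^L(z)+\partial f_i^U(z)]+\sum_{j\in J}\lambda_j\,\mathrm{co}\{\partial_x g_j(z,v_j): v_j\in\mathcal{V}_j(z)\}+N(z;S)+\sqrt{\theta}\,\mathbb{B},$$ $$\lambda_j>0\ \text{ for all } j\in J \text{ satisfying } 0<g_j(z)\le\sqrt{\theta},$$ $$\lambda_j=0\ \text{ if } g_j(z)\le 0.$$
   Context: Setting. $\mathbb{R}^n$ carries the Euclidean norm $\|\cdot\|$; $\mathbb{B}$ is its closed unit ball and $B(x,\rho)$ the open ball. $I=\{1,\ldots,m\}$, $J=\{1,\ldots,p\}$. $\mathcal{K}_c$ is the set of closed bounded intervals $[a^L,a^U]$, $a^L\le a^U$. $S\subset\mathbb{R}^n$ is nonempty and closed. For $i\in I$, $f_i(x)=[f_i^L(x),f_i^U(x)]\in\mathcal{K}_c$, where $f_i^L,f_i^U:\mathbb{R}^n\to\mathbb{R}$ are locally Lipschitz with $f_i^L(x)\le f_i^U(x)$. For $j\in J$, $\mathcal{V}_j\subset\mathbb{R}^{n_j}$ is nonempty compact and $g_j:\mathbb{R}^n\times\mathbb{R}^{n_j}\to\mathbb{R}$. Put $g_j(x):=\max_{v_j\in\mathcal{V}_j}g_j(x,v_j)$ and $\mathcal{V}_j(x):=\{v_j\in\mathcal{V}_j: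 g_j(x,v_j)=g_j(x)\}$. Standing conditions on $g_j$: for every $\bar x\in\mathbb{R}^n$ and $j\in J$ there is $\delta>0$ such that (a) $v_j\in\mathcal{V}_j\mapsto g_j(x,v_j)$ is upper semicontinuous for each $x\in B(\bar x,\delta)$, and the functions $g_j(\cdot,v_j)$, $v_j\in\mathcal{V}_j$, are Lipschitz on $B(\bar x,\delta)$ with a common constant $K_j$; (b) the multifunction $(x,v_j)\in B(\bar x,\delta)\times\mathcal{V}_j\rightrightarrows\partial_x g_j(x,v_j)$ is closed at $(\bar x,\bar v_j)$ for each $\bar v_j\in\mathcal{V}_j(\bar x)$ (i.e. if $(x^k,v^k)\to(\bar x,\bar v_j)$, $x_k^*\in\partial_x g_j(x^k,v^k)$, $x_k^*\to x^*$, then $x^*\in\partial_x g_j(\bar x,\bar v_j)$). $N(x;S)$ is the limiting (Mordukhovich) normal cone to $S$ at $x$; $\partial$ is the limiting (Mordukhovich) subdifferential, $\partial_x$ the limiting subdifferential in the variable $x$; $\mathrm{co}$ denotes convex hull. Fix reals $0\le\epsilon_i^L\le\epsilon_i^U$, $i\in I$, with $\theta:=\sum_{i\in I}(\epsilon_i^L+\epsilon_i^U)>0$. Put $\mathcal{E}_i:=[\epsilon_i^L,\epsilon_i^U]$, $\mathcal{E}:=(\mathcal{E}_1,\ldots,\mathcal{E}_m)$. (RMP) is the problem of minimizing $(f_1,\ldots,f_m)$ with respect to the order below over $\Omega:=\{x\in S: g_j(x,v_j)\le0\ \forall v_j\in\mathcal{V}_j,\ \forall j\in J\}=\{x\in S: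 g_j(x)\le 0,\ j\in J\}$. Put $\Omega_{\mathcal{E}}:=\{x\in S: g_j(x)\le\sqrt{\theta},\ j\in J\}$. Intervals: $[a^L,a^U]-[b^L,b^U]=[a^L-b^U,a^U-b^L]$; $k[a^L,a^U]=[ka^L,ka^U]$ for $k\ge0$; $A\le_{LU}B$ iff $a^L\le b^L$ and $a^U\le b^U$; $A<_{LU}B$ iff $A\le_{LU}B$ and $A\ne B$. A point $\bar x\in\Omega_{\mathcal{E}}$ is an almost $\mathcal{E}$-Pareto solution of (RMP) if there is no $x\in\Omega$ with $f_i(x)\le_{LU}f_i(\bar x)-\mathcal{E}_i$ for all $i\in I$ and $f_k(x)<_{LU}f_k(\bar x)-\mathcal{E}_k$ for at least one $k\in I$. It is an almost $\mathcal{E}$-quasi Pareto solution of (RMP) if there is no $x\in\Omega$ with $f_i(x)\le_{LU}f_i(\bar x)-\frac{\mathcal{E}_i}{\sqrt\theta}\|x-\bar x\|$ for all $i\in I$ and $f_k(x)<_{LU}f_k(\bar x)-\frac{\mathcal{E}_k}{\sqrt\theta}\|x-\bar x\|$ for at least one $k\in I$. It is an almost regular $\mathcal{E}$-Pareto solution if it is both.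
   Formalization: The formal theorem also assumes that the feasible set Ω of (RMP) is nonempty; without it the claim fails, e.g. for S = R^n and one constraint g_1 constant equal to 1+√θ, where Ω_E is empty and no almost E-Pareto solution exists. *)

(* Defs.v *)
From HB Require Import structures.
From mathcomp Require Import all_boot all_order all_algebra.
From mathcomp Require Import all_classical all_reals all_analysis.

Set Implicit Arguments.
Unset Strict Implicit.
Unset Printing Implicit Defensive.

Import Order.TTheory GRing.Theory Num.Theory.
Import numFieldNormedType.Exports.

Local Open Scope classical_set_scope.
Local Open Scope ring_scope.

Section Euclidean.
Context {R : realType}.

Definition dotv n (u v : 'rV[R]_n) : R := \sum_(i < n) u 0 i * v 0 i.

(* The library's norm `|x| on 'rV[R]_n is the sup norm, hence this one. It
   induces the same topology, so nbhs, closed, compact and convergence of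
   sequences are taken from the library. *)
Definition enorm n (u : 'rV[R]_n) : R := Num.sqrt (dotv u u).

Definition eball n (x : 'rV[R]_n) (r : R) : set 'rV[R]_n :=
  [set y | enorm (y - x) < r].

Definition closed_unit_ball {n} : set 'rV[R]_n := [set y | enorm y <= 1].

Definition lipschitz_with n (K : R) (A : set 'rV[R]_n) (f : 'rV[R]_n -> R) :=
  forall x y, A x -> A y -> `|f x - f y| <= K * enorm (x - y).

Definition locally_lipschitz n (f : 'rV[R]_n -> R) :=
  forall x, exists2 r : R, 0 < r & exists K : R, lipschitz_with K (eball x r) f.

Definition usc_on n (A : set 'rV[R]_n) (f : 'rV[R]_n -> R) :=
  forall v, A v -> forall c, f v < c -> \forall w \near within A (nbhs v), f w < c.

End Euclidean.

Section SetAlgebra.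
Context {R : realType} {n : nat}.
Implicit Types A B : set 'rV[R]_n.

Definition mink_sum A B : set 'rV[R]_n := [set u | exists x y, [/\ A x, B y & u = x + y]].

Definition mink_bigsum (I : finType) (A : I -> set 'rV[R]_n) : set 'rV[R]_n :=
  [set u | exists x : I -> 'rV[R]_n, (forall i, A i (x i)) /\ u = \sum_i x i].

Definition mink_scale (k : R) A : set 'rV[R]_n := [set k *: x | x in A].

Definition co A : set 'rV[R]_n :=
  [set u | exists (k : nat) (a : 'I_k -> R) (x : 'I_k -> 'rV[R]_n),
     [/\ forall i, 0 <= a i, \sum_i a i = 1, forall i, A (x i)
       & u = \sum_i a i *: x i]].

End SetAlgebra.

Section Mordukhovich.
Context {R : realType}.

(* xs is in it iff limsup <xs, u - x> / |u - x| <= 0 as u -> x within S. *)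
Definition regular_normal_cone n (x : 'rV[R]_n) (S : set 'rV[R]_n) : set 'rV[R]_n :=
  [set xs | S x /\ forall e : R, 0 < e ->
     \forall u \near within S (nbhs x), dotv xs (u - x) <= e * enorm (u - x)].

Definition normal_cone n (x : 'rV[R]_n) (S : set 'rV[R]_n) : set 'rV[R]_n :=
  [set xs | S x /\ exists xk xsk : nat -> 'rV[R]_n,
     [/\ xk @ \oo --> x, xsk @ \oo --> xs
       & forall k, regular_normal_cone (xk k) S (xsk k)]].

(* R^n x R is represented by 'rV_(n + 1), the last entry being the ordinate. *)
Definition pairv n (x : 'rV[R]_n) (a : R) : 'rV[R]_(n + 1) := row_mx x a%:M.

Definition epigraph n (f : 'rV[R]_n -> R) : set 'rV[R]_(n + 1) :=
  [set pairv z.1 z.2 | z in [set z : 'rV[R]_n * R | f z.1 <= z.2]].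

Definition limsub n (f : 'rV[R]_n -> R) (x : 'rV[R]_n) : set 'rV[R]_n :=
  [set xs | normal_cone (pairv x (f x)) (epigraph f) (pairv xs (-1))].

End Mordukhovich.

Section Intervals.
Context {R : realType}.

(* [lo, hi] by its endpoints; membership in K_c, i.e. lo <= hi, is Kc. *)
Record ival := IVal { lo : R ; hi : R }.

Definition Kc : set ival := [set A | lo A <= hi A].

Definition isub (A B : ival) : ival := IVal (lo A - hi B) (hi A - lo B).

(* Only meaningful for 0 <= k. *)
Definition iscale (k : R) (A : ival) : ival := IVal (k * lo A) (k * hi A).

Definition le_LU (A B : ival) : Prop := lo A <= lo B /\ hi A <= hi B.

Definition lt_LU (A B : ival) : Prop := le_LU A B /\ A <> B.

Definition dominates m (A B : 'I_m -> ival) : Prop :=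
  (forall i, le_LU (A i) (B i)) /\ exists k, lt_LU (A k) (B k).

End Intervals.
Arguments ival : clear implicits.

Unset Implicit Arguments.

Section RobustProblem.
Context {R : realType} {n m p : nat} {q : 'I_p -> nat}.
Variables (S : set 'rV[R]_n) (f : 'I_m -> 'rV[R]_n -> ival R).
Variables (V : forall j, set 'rV[R]_(q j)).
Variables (g : forall j, 'rV[R]_n -> 'rV[R]_(q j) -> R).
Variables (E : 'I_m -> ival R).

(* The supremum is a maximum when V j is nonempty and compact and g j x is
   upper semicontinuous on V j. *)
Definition gmax (j : 'I_p) (x : 'rV[R]_n) : R := sup [set g j x v | v in V j].

Definition active (j : 'I_p) (x : 'rV[R]_n) : set 'rV[R]_(q j) :=
  [set v | V j v /\ g j x v = gmax j x].

Definition uniform_regularity (j : 'I_p) (xb : 'rV[R]_n) (d : R) : Prop :=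
  (forall x, eball xb d x -> usc_on (V j) (g j x)) /\
  exists K : R, forall v, V j v -> lipschitz_with K (eball xb d) (fun x => g j x v).

Definition subdiff_closed (j : 'I_p) (xb : 'rV[R]_n) (d : R) : Prop :=
  forall vb, active j xb vb ->
  forall (xk : nat -> 'rV[R]_n) (vk : nat -> 'rV[R]_(q j))
         (xsk : nat -> 'rV[R]_n) (xs : 'rV[R]_n),
    (forall k, eball xb d (xk k)) -> (forall k, V j (vk k)) ->
    (forall k, limsub (fun x => g j x (vk k)) (xk k) (xsk k)) ->
    xk @ \oo --> xb -> vk @ \oo --> vb -> xsk @ \oo --> xs ->
    limsub (fun x => g j x vb) xb xs.

Definition constraint_conditions : Prop :=
  forall (xb : 'rV[R]_n) (j : 'I_p),
    exists2 d : R, 0 < d & uniform_regularity j xb d /\ subdiff_closed j xb d.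

Definition theta : R := \sum_(i < m) (lo (E i) + hi (E i)).

Definition Omega : set 'rV[R]_n :=
  [set x | S x /\ forall j v, V j v -> g j x v <= 0].

Definition OmegaE : set 'rV[R]_n :=
  [set x | S x /\ forall j, gmax j x <= Num.sqrt theta].

Definition almost_pareto (z : 'rV[R]_n) : Prop :=
  OmegaE z /\
  ~ exists x, Omega x /\
      dominates (fun i => f i x) (fun i => isub (f i z) (E i)).

Definition almost_quasi_pareto (z : 'rV[R]_n) : Prop :=
  OmegaE z /\
  ~ exists x, Omega x /\
      dominates (fun i => f i x)
        (fun i => isub (f i z)
           (iscale (enorm (x - z)) (iscale (Num.sqrt theta)^-1 (E i)))).

Definition almost_regular_pareto (z : 'rV[R]_n) : Prop :=
  almost_pareto z /\ almost_quasi_pareto z.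

End RobustProblem.

(* Main.v *)
Require Import Defs.
From HB Require Import structures.
From mathcomp Require Import all_boot all_order all_algebra.
From mathcomp Require Import all_classical all_reals all_analysis.
From mathcomp Require Import ring lra.

Set Implicit Arguments.
Unset Strict Implicit.
Unset Printing Implicit Defensive.

Import Order.TTheory GRing.Theory Num.Theory.
Import numFieldNormedType.Exports.

Local Open Scope classical_set_scope.
Local Open Scope ring_scope.

(** The multipliers come from an exterior penalty. With phi the sum of all end
    points of the objectives and G_j the constraint functions max over v of
    g_j(., v), the function Psi = phi + r * (sum over j of max(G_j, 0)^2) is
    continuous and bounded below on S. A point x0 that minimizes Psi on S up to
    theta is replaced by a minimizer z of Psi + sqrt(theta) |. - x0| on S, as in
    Ekeland's principle [approximate_minimizer]. Then z minimizes Psi on S up to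
    theta, and it minimizes Psi + sqrt(theta) |. - z| on S exactly. As Psi = phi
    on the feasible set, a feasible point that dominates z in either sense would
    contradict one of these facts. The penalty at z is at most r * theta once r
    is large, hence G_j(z) <= sqrt(theta).

    The inclusion is the sum rule [sum_rule] for the second minimization. The
    cone sqrt(theta) |. - z| is sqrt(theta)-Lipschitz and contributes a vector of
    the ball. The penalty of the constraint j contributes 2 r max(G_j(z), 0)
    times a subgradient of G_j at z [penalty_subgrad], and only 0 when
    G_j(z) <= 0 [penalty_subgrad_eq0]; so lambda_j = 2 r max(G_j(z), 0).

    All subgradients are obtained as limits of proximal ones, which are limiting
    subgradients [prox_limsub_sub]. The sum rule is proved by giving every
    summand its own copy of the variable, tied to a point of S by a quadratic
    penalty: minimizing over a compact product, one reads off a proximal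
    subgradient from each copy and a proximal normal from the point of S, almost
    summing to zero; then one passes to the limit.

    The subgradients of G_j lie in the convex hull of those of g_j(., v), v
    active, by the maximum rule [gmax_subgrad]. Given a subgradient u of G_j and a
    direction w, a short step along w and the mean value inequality [mean_value],
    itself an instance of the sum rule on a segment, give subgradients of g_j(., v)
    near z, with v nearly active, whose pairing with w is at least that of u up to
    a small error; compactness of V_j and the closedness condition turn them into
    an active subgradient at z [active_limit]. A vector whose pairing in every
    direction is matched by some element of a compact set lies in the convex hull
    of that set, by Caratheodory's theorem [co_of_support]. *)

(** * Euclidean geometry and the topology of row vectors *)

Section EuclideanNorm.
Context {R : realType} {n : nat}.
Implicit Types (u v w x y z : 'rV[R]_n) (a b e : R).

Lemma dotvC u v : dotv u v = dotv v u.
Proof. by apply: eq_bigr => i _; rewrite mulrC. Qed.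

Lemma dotvDl u v w : dotv (u + v) w = dotv u w + dotv v w.
Proof. by rewrite -big_split; apply: eq_bigr => i _; rewrite mxE mulrDl. Qed.

Lemma dotvZl a u v : dotv (a *: u) v = a * dotv u v.
Proof. by rewrite mulr_sumr; apply: eq_bigr => i _; rewrite mxE mulrA. Qed.

Lemma dotvNl u v : dotv (- u) v = - dotv u v.
Proof. by rewrite -scaleN1r dotvZl mulN1r. Qed.

Lemma dotvDr u v w : dotv u (v + w) = dotv u v + dotv u w.
Proof. by rewrite dotvC dotvDl !(dotvC _ u). Qed.

Lemma dotvZr a u v : dotv u (a *: v) = a * dotv u v.
Proof. by rewrite dotvC dotvZl dotvC. Qed.

Lemma dotvNr u v : dotv u (- v) = - dotv u v.
Proof. by rewrite dotvC dotvNl dotvC. Qed.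

Lemma dot0v u : dotv 0 u = 0.
Proof. by rewrite -(scale0r 0) dotvZl mul0r. Qed.

Lemma dotv0 u : dotv u 0 = 0.
Proof. by rewrite dotvC dot0v. Qed.

Lemma dotv_suml (T : finType) (F : T -> 'rV[R]_n) u :
  dotv (\sum_t F t) u = \sum_t dotv (F t) u.
Proof.
elim/big_rec2: _ => [|t a v _ <-]; first exact: dot0v.
by rewrite dotvDl.
Qed.

Definition dotvE := (dotvDl, dotvDr, dotvNl, dotvNr, dotvZl, dotvZr).

Lemma dotvv_ge0 u : 0 <= dotv u u.
Proof. by apply: sumr_ge0 => i _; rewrite -expr2 sqr_ge0. Qed.

Lemma enorm_ge0 u : 0 <= enorm u.
Proof. exact: sqrtr_ge0. Qed.

Lemma enorm_sqr u : enorm u ^+ 2 = dotv u u.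
Proof. by rewrite sqr_sqrtr // dotvv_ge0. Qed.

Lemma dotvv_eq0 u : dotv u u = 0 -> u = 0.
Proof.
move=> /eqP; rewrite psumr_eq0; last by move=> i _; rewrite -expr2 sqr_ge0.
move=> /allP u0; apply/rowP => i; rewrite mxE; apply/eqP.
by have := u0 i; rewrite mem_index_enum -expr2 sqrf_eq0; apply.
Qed.

Lemma enorm0 : enorm (0 : 'rV[R]_n) = 0.
Proof. by rewrite /enorm dot0v sqrtr0. Qed.

Lemma enorm_eq0 u : enorm u = 0 -> u = 0.
Proof. by move=> u0; apply: dotvv_eq0; rewrite -enorm_sqr u0 expr0n. Qed.

Lemma enorm_gt0 u : u <> 0 -> 0 < enorm u.
Proof.
by move=> u0; rewrite lt_neqAle enorm_ge0 andbT eq_sym; apply/eqP => /enorm_eq0.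
Qed.

Lemma enormZ a u : enorm (a *: u) = `|a| * enorm u.
Proof. by rewrite /enorm dotvZl dotvZr mulrA -expr2 sqrtrM ?sqr_ge0 // sqrtr_sqr. Qed.

Lemma enormN u : enorm (- u) = enorm u.
Proof. by rewrite -scaleN1r enormZ normrN1 mul1r. Qed.

Lemma enormB u v : enorm (u - v) = enorm (v - u).
Proof. by rewrite -enormN opprB. Qed.

Lemma cauchy_schwarz u v : dotv u v <= enorm u * enorm v.
Proof.
have [->|u0] := pselect (u = 0); first by rewrite dot0v enorm0 mul0r.
have [->|v0] := pselect (v = 0); first by rewrite dotv0 enorm0 mulr0.
have pu := enorm_gt0 u0; have pv := enorm_gt0 v0.
have := dotvv_ge0 (enorm v *: u - enorm u *: v).
rewrite !dotvE -!enorm_sqr (dotvC v u).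
set a := enorm u in pu *; set b := enorm v in pv *; set d := dotv u v => H.
have ab0 := mulr_gt0 pu pv; rewrite -(ler_pM2l ab0).
lra.
Qed.

Lemma enormD u v : enorm (u + v) <= enorm u + enorm v.
Proof.
rewrite -(@ler_pXn2r _ 2) ?nnegrE ?addr_ge0 ?enorm_ge0 //.
rewrite enorm_sqr !dotvE -!enorm_sqr (dotvC v u).
have := cauchy_schwarz u v; nra.
Qed.

Lemma enorm_triangle v u w : enorm (u - w) <= enorm (u - v) + enorm (v - w).
Proof. by have := enormD (u - v) (v - w); rewrite addrA subrK. Qed.

Lemma coord_le_enorm u i : `|u 0 i| <= enorm u.
Proof.
rewrite -(@ler_pXn2r _ 2) ?nnegrE ?enorm_ge0 // enorm_sqr real_normK ?num_real //.
rewrite /dotv (bigD1 i) //= -expr2 lerDl sumr_ge0 // => j _.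
by rewrite -expr2 sqr_ge0.
Qed.

Lemma enorm_lt_coord u e : 0 < e ->
  (forall i, `|u 0 i| < e) -> enorm u < n.+1%:R * e.
Proof.
move=> e0 ue; have ne0 : 0 <= n.+1%:R * e by rewrite mulr_ge0 ?ltW.
rewrite -(@ltr_pXn2r _ 2) ?nnegrE ?enorm_ge0 // enorm_sqr.
apply: (@le_lt_trans _ _ (\sum_(i < n) e ^+ 2)).
  apply: ler_sum => i _; rewrite -expr2 -real_normK ?num_real //.
  by rewrite ler_pXn2r ?nnegrE ?(ltW e0) // ltW.
rewrite sumr_const card_ord -[_ *+ n]mulr_natl exprMn ltr_pM2r ?exprn_gt0 //.
by rewrite -natrX ltr_nat expnS expn1 leq_pmulr.
Qed.

(** Row vectors carry the topology of the sup norm; limits and neighbourhoods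
    below all pass through this comparison with Euclidean balls. *)
Lemma nbhs_enormP x (P : set 'rV[R]_n) :
  nbhs x P <-> exists2 e, 0 < e & forall y, enorm (y - x) < e -> P y.
Proof.
split=> [/nbhs_ballP [e /= e0 xP]|[e e0 xP]].
  exists e => // y yx; apply: xP; split=> // i j; rewrite (ord1 i).
  rewrite /ball /= distrC; apply: le_lt_trans yx.
  by have := coord_le_enorm (y - x) j; rewrite !mxE.
apply/nbhs_ballP; exists (e / n.+1%:R) => /=; first by rewrite divr_gt0.
move=> y xy; apply: xP; have -> : e = n.+1%:R * (e / n.+1%:R).
  by rewrite mulrC divfK.
apply: enorm_lt_coord => [|i]; first by rewrite divr_gt0.
by have := xy.2 0 i; rewrite /ball /= distrC !mxE.
Qed.

Lemma nbhs_eball x e : 0 < e -> nbhs x (eball x e).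
Proof. by move=> e0; apply/nbhs_enormP; exists e. Qed.

Lemma cvg_enorm (u : nat -> 'rV[R]_n) x :
  (forall k, enorm (u k - x) < k.+1%:R^-1) -> u @ \oo --> x.
Proof.
move=> ux P /nbhs_enormP [e e0 eP].
have := near_infty_natSinv_lt (PosNum e0); rewrite nearE => H.
apply: filterS H => k /= ke; apply: eP; exact: lt_trans (ux k) ke.
Qed.

End EuclideanNorm.

Section Continuity.
Context {R : realType} {n : nat}.
Implicit Types (h : 'rV[R]_n -> R) (x y z : 'rV[R]_n).

Lemma enorm_lipschitz z x y : `|enorm (x - z) - enorm (y - z)| <= enorm (x - y).
Proof.
rewrite ler_norml; have := enorm_triangle y x z; have := enorm_triangle x y z.
by rewrite (enormB y x); lra.
Qed.

(** A Lipschitz constant can be negative on a one-point set, such as a ball in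
    dimension 0. *)
Lemma lipschitz_with_pos (K : R) (A : set 'rV[R]_n) h :
  lipschitz_with K A h -> exists2 L, 0 < L & lipschitz_with L A h.
Proof.
move=> Kh; exists (`|K| + 1); first by rewrite ltr_wpDl.
move=> x y Ax Ay; apply: le_trans (Kh _ _ Ax Ay) _.
by apply: ler_wpM2r; rewrite ?enorm_ge0 // ler_wpDr // ler_norm.
Qed.

Lemma locally_lipschitz_continuous h : locally_lipschitz h -> continuous h.
Proof.
move=> hL x; have [r r0 [K0 /lipschitz_with_pos [K K0' hK]]] := hL x.
move=> A /nbhs_ballP [e /= e0 eA]; apply/nbhs_enormP.
exists (Num.min r (e / K)); first by rewrite lt_min r0 divr_gt0.
move=> y; rewrite lt_min ltr_pdivlMr // => /andP[yr ye]; apply: eA.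
apply: le_lt_trans (hK _ _ _ yr) _; first by rewrite /eball /= subrr enorm0.
by rewrite mulrC enormB.
Qed.

Lemma enorm_locally_lipschitz z : locally_lipschitz (fun x => enorm (x - z)).
Proof.
move=> x; exists 1 => //; exists 1 => u v _ _; rewrite mul1r.
exact: enorm_lipschitz.
Qed.

Lemma enorm_continuous z : continuous (fun x => enorm (x - z)).
Proof. exact/locally_lipschitz_continuous/enorm_locally_lipschitz. Qed.

Lemma closed_enorm_le z (r : R) : closed [set y | enorm (y - z) <= r].
Proof.
apply: (@preimage_closed _ _ (fun y => enorm (y - z)) [set a : R | a <= r]).
  by move=> y _; exact: enorm_continuous.
exact: closed_le.
Qed.

Lemma compact_enorm_le z (r : R) : compact [set y | enorm (y - z) <= r].
Proof.
apply: bounded_closed_compact; last exact: closed_enorm_le.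
exists (`|z| + `|r|); split; first by rewrite num_real.
move=> M zrM y /= yz; apply: le_trans (ltW zrM).
rewrite -{1}(subrK z y) (le_trans (ler_normD _ _)) // addrC lerD2l.
apply: le_trans (ler_norm r); apply: le_trans yz.
rewrite {1}/Num.norm /=; have [->|/eqP/mx_norm_neq0 [[i j] ->]] :=
  pselect (mx_norm (y - z) = 0); first exact: enorm_ge0.
by rewrite (ord1 i); exact: coord_le_enorm.
Qed.

End Continuity.

(** * Limits of proximal subgradients and of proximal normals *)

Section Proximal.
Context {R : realType} {n : nat}.
Implicit Types (h : 'rV[R]_n -> R) (S : set 'rV[R]_n) (x y z u : 'rV[R]_n).

Definition prox_subgrad h x u : Prop :=
  exists s r : R, [/\ 0 < s, 0 < r & forall y, enorm (y - x) < r ->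
    h x + dotv u (y - x) - s * dotv (y - x) (y - x) <= h y].

Definition prox_normal S x u : Prop :=
  S x /\ exists s r : R, [/\ 0 < s, 0 < r & forall y, S y -> enorm (y - x) < r ->
    dotv u (y - x) <= s * dotv (y - x) (y - x)].

(** Limits of proximal objects, phrased by closeness rather than by sequences
    because optimality conditions yield them up to an arbitrary error. *)
Definition prox_limsub h z : set 'rV[R]_n :=
  [set u | forall e, 0 < e -> exists x v,
     [/\ enorm (x - z) < e, enorm (v - u) < e & prox_subgrad h x v]].

Definition prox_limnormal S z : set 'rV[R]_n :=
  [set u | forall e, 0 < e -> exists x v,
     [/\ enorm (x - z) < e, enorm (v - u) < e & prox_normal S x v]].

(** A quadratic error is eventually smaller than any linear one. *)
Lemma prox_normal_regular S x u : prox_normal S x u -> regular_normal_cone x S u.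
Proof.
move=> [Sx [s [r [s0 r0 H]]]]; split=> // e e0.
apply/nbhs_enormP; exists (Num.min r (e / s)); first by rewrite lt_min r0 divr_gt0.
move=> y; rewrite lt_min ltr_pdivlMr // => /andP[yr ye] Sy.
apply: le_trans (H _ Sy yr) _; rewrite -enorm_sqr expr2 mulrA.
by apply: ler_wpM2r; [exact: enorm_ge0|rewrite mulrC ltW].
Qed.

Lemma prox_limnormal_sub S z : S z -> prox_limnormal S z `<=` normal_cone z S.
Proof.
move=> Sz u zu; split=> //.
have /choice [p Hp] (k : nat) : exists p : 'rV[R]_n * 'rV[R]_n,
    [/\ enorm (p.1 - z) < k.+1%:R^-1, enorm (p.2 - u) < k.+1%:R^-1
      & prox_normal S p.1 p.2].
  by have [|x [v ?]] := zu k.+1%:R^-1; [rewrite invr_gt0|exists (x, v)].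
exists (fun k => (p k).1), (fun k => (p k).2); split=> [||k].
- by apply: cvg_enorm => k; have [] := Hp k.
- by apply: cvg_enorm => k; have [] := Hp k.
- by apply: prox_normal_regular; have [] := Hp k.
Qed.

Lemma pairvB x y (a b : R) : pairv x a - pairv y b = pairv (x - y) (a - b).
Proof. by rewrite /pairv opp_row_mx add_row_mx raddfB. Qed.

Lemma dotv_pairv x y (a b : R) : dotv (pairv x a) (pairv y b) = dotv x y + a * b.
Proof.
rewrite /dotv big_split_ord /= big_ord1; congr (_ + _).
  by apply: eq_bigr => i _; rewrite !row_mxEl.
by rewrite !row_mxEr !mxE.
Qed.

Lemma enorm_pairv_le x (a : R) : enorm (pairv x a) <= enorm x + `|a|.
Proof.
rewrite -(@ler_pXn2r _ 2) ?nnegrE ?addr_ge0 ?enorm_ge0 //.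
rewrite enorm_sqr dotv_pairv -enorm_sqr sqrrD (real_normK (num_real a)).
have := mulr_ge0 (enorm_ge0 x) (normr_ge0 a); rewrite -expr2; lra.
Qed.

Lemma le_enorm_pairv x (a : R) : enorm x <= enorm (pairv x a).
Proof.
rewrite -(@ler_pXn2r _ 2) ?nnegrE ?enorm_ge0 //.
by rewrite !enorm_sqr dotv_pairv lerDl -expr2 sqr_ge0.
Qed.

End Proximal.

Section ProximalEpigraph.
Context {R : realType} {n : nat}.
Implicit Types (h : 'rV[R]_n -> R) (x z u : 'rV[R]_n).

(** Raising the ordinate above the graph only decreases the pairing with
    (u, -1), so the subgradient inequality becomes a normal inequality. *)
Lemma prox_subgrad_epigraph h x u : prox_subgrad h x u ->
  prox_normal (epigraph h) (pairv x (h x)) (pairv u (- 1)).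
Proof.
move=> [s [r [s0 r0 H]]]; split; first by exists (x, h x) => //=.
exists s, r; split=> // _ [[y b] /= hyb <-]; rewrite pairvB => yr.
have yr' := le_lt_trans (le_enorm_pairv _ _) yr.
have := H _ yr'; rewrite !dotv_pairv => Hy.
have := mulr_ge0 (ltW s0) (sqr_ge0 (b - h x)); rewrite expr2 mulrDr; lra.
Qed.

Lemma prox_limsub_sub h z : continuous h -> prox_limsub h z `<=` limsub h z.
Proof.
move=> hc u zu; apply: prox_limnormal_sub; first by exists (z, h z) => //=.
move=> e e0; have e20 : 0 < e / 2 by rewrite divr_gt0.
have /nbhs_enormP [d d0 dh] : nbhs z [set x | `|h z - h x| < e / 2].
  exact: hc (nbhsx_ballx (h z) _ e20).
have [|x [v [xz vu xv]]] := zu (Num.min d (e / 2)); first by rewrite lt_min d0.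
move: xz vu; rewrite !lt_min => /andP[xd xe] /andP[_ ve].
exists (pairv x (h x)), (pairv v (- 1)); split.
- rewrite pairvB (le_lt_trans (enorm_pairv_le _ _)) // (splitr e) ltrD //.
  by rewrite distrC; exact: dh.
- rewrite pairvB subrr (le_lt_trans (enorm_pairv_le _ _)) // normr0 addr0.
  by apply: lt_le_trans ve _; rewrite ler_pdivrMr // ler_pMr // ler1n.
- exact: prox_subgrad_epigraph.
Qed.

End ProximalEpigraph.

Section ProximalCalculus.
Context {R : realType} {n : nat}.
Implicit Types (h : 'rV[R]_n -> R) (x y z u l : 'rV[R]_n).

Lemma prox_subgrad_linear h l x u :
  prox_subgrad (fun y => h y - dotv l y) x u -> prox_subgrad h x (u + l).
Proof.
move=> [s [r [s0 r0 H]]]; exists s, r; split=> // y /H.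
by rewrite (dotvDl u) (dotvDr l) (dotvNr l); lra.
Qed.

Lemma prox_limsub_linear h l z u :
  prox_limsub (fun y => h y - dotv l y) z u -> prox_limsub h z (u + l).
Proof.
move=> zu e /zu [x [v [xz vu xv]]]; exists x, (v + l); split=> //.
  by rewrite opprD addrACA subrr addr0.
exact: prox_subgrad_linear.
Qed.

(** Test the inequality at x + t u for small t. *)
Lemma prox_subgrad_lipschitz h x u (r K : R) : 0 < r -> 0 <= K ->
  lipschitz_with K (eball x r) h -> prox_subgrad h x u -> enorm u <= K.
Proof.
move=> r0 K0 hK [s [q [s0 q0 H]]].
have [->|u0] := pselect (u = 0); first by rewrite enorm0.
have pu := enorm_gt0 u0; apply/ler_addgt0Pr => e e0.
pose t := Num.min (Num.min r q / (2 * enorm u)) (e / (s * enorm u)).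
have t0 : 0 < t by rewrite lt_min !divr_gt0 ?mulr_gt0 ?lt_min ?r0 ?q0.
have tB : t * enorm u < Num.min r q.
  apply: (@le_lt_trans _ _ (Num.min r q / 2)).
    rewrite -ler_pdivlMr // -mulrA -invfM /t ge_min lexx //.
  by rewrite ltr_pdivrMr // ltr_pMr ?ltr1n // lt_min r0.
have tE : s * (t * enorm u) <= e.
  rewrite mulrCA -ler_pdivlMr ?mulr_gt0 // /t ge_min lexx orbT //.
have n_tu : enorm (t *: u) = t * enorm u by rewrite enormZ gtr0_norm.
move: tB; rewrite lt_min => /andP[tr tq].
have xtu : x + t *: u - x = t *: u by rewrite addrC addKr.
have := H (x + t *: u); rewrite xtu n_tu => /(_ tq).
have /ler_normlP [+ _] : `|h x - h (x + t *: u)| <= K * (t * enorm u).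
  have -> : t * enorm u = enorm (x - (x + t *: u)) by rewrite enormB xtu.
  apply: hK.
    by rewrite /eball /= subrr enorm0.
  by rewrite /eball /= xtu n_tu.
rewrite dotvZr -!enorm_sqr n_tu => H1 H2; have tu0 := mulr_gt0 t0 pu.
rewrite -(ler_pM2l tu0).
have := ler_wpM2l (ltW tu0) tE; lra.
Qed.

Lemma prox_limsub_lipschitz h z u (r K : R) : 0 < r -> 0 <= K ->
  lipschitz_with K (eball z r) h -> prox_limsub h z u -> enorm u <= K.
Proof.
move=> r0 K0 hK zu; apply/ler_addgt0Pr => e e0.
have [|x [v [xz vu xv]]] := zu (Num.min (r / 2) e).
  by rewrite lt_min e0 divr_gt0.
move: xz vu; rewrite !lt_min => /andP[xr _] /andP[_ ve].
have vK : enorm v <= K.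
  apply: (@prox_subgrad_lipschitz h x v (r / 2) K) => //; first by rewrite divr_gt0.
  have sub w : eball x (r / 2) w -> eball z r w.
    rewrite /eball /= => wx; apply: le_lt_trans (enorm_triangle x w z) _.
    by rewrite (splitr r) ltrD.
  by move=> w w' /sub wz /sub wz'; exact: hK.
have := enormD v (u - v); rewrite addrC subrK enormB; lra.
Qed.

End ProximalCalculus.

(** * Compactness *)

(** Stands in for the extraction of convergent subsequences: A e collects the
    candidates that are right up to an error e. *)
Lemma compact_accumulation (R : realType) (T : topologicalType) (K : set T)
    (A : R -> set T) : compact K ->
  (forall e, 0 < e -> A e !=set0) -> (forall e, 0 < e -> A e `<=` K) ->
  (forall d e, d <= e -> A d `<=` A e) ->
  exists2 x, K x & forall e U, 0 < e -> nbhs x U -> A e `&` U !=set0.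
Proof.
move=> cK A0 AK Amono; pose F := filter_from [set e : R | 0 < e] A.
have FF : ProperFilter F.
  apply: filter_from_proper A0; apply: filter_from_filter; first by exists 1 => /=.
  move=> d e /= d0 e0; exists (Num.min d e); first by rewrite /= lt_min d0.
  by move=> x Ax; split; apply: Amono Ax; rewrite ge_min lexx ?orbT.
have [|x [Kx clx]] := cK F FF; first by exists 1; [exact: ltr01|exact: AK].
exists x => // e U e0 xU; apply: clx xU; exists e => //.
Qed.

(** The superlevel sets of f, one for each value taken, form a filter base; at a
    point where they accumulate no larger value is possible. *)
Lemma compact_usc_max (R : realType) q (K : set 'rV[R]_q) (f : 'rV[R]_q -> R) :
  compact K -> K !=set0 -> usc_on K f ->
  exists2 v, K v & forall w, K w -> f w <= f v.
Proof.
move=> cK K0 uf; pose F := filter_from K (fun v => [set w | K w /\ f v <= f w]).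
have FF : ProperFilter F.
  apply: filter_from_proper; last by move=> v Kv; exists v => /=.
  apply: filter_from_filter => // v w Kv Kw.
  have [vw|/ltW wv] := leP (f v) (f w); [exists w => //|exists v => //].
    by move=> u /= [Ku wu]; do !split=> //; exact: le_trans vw _.
  by move=> u /= [Ku vu]; do !split=> //; exact: le_trans wv _.
have [|x [Kx clx]] := cK F FF; first by have [v Kv] := K0; exists v => // w [].
exists x => // w Kw; rewrite leNgt; apply/negP => xw.
have Fw : F [set u | K u /\ f w <= f u] by exists w.
have [u [[Ku wu] /(_ Ku)]] := clx _ _ Fw (uf x Kx _ xw).
by rewrite ltNge wu.
Qed.

(** * Sums and products of continuous functions on an arbitrary space *)

Section ContinuousCombinations.
Context {R : realType} {X : topologicalType}.

Lemma continuous_add (V : normedModType R) (f g : X -> V) :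
  continuous f -> continuous g -> continuous (fun x => f x + g x).
Proof. by move=> cf cg x; apply: cvgD; [exact: cf|exact: cg]. Qed.

Lemma continuous_sub (V : normedModType R) (f g : X -> V) :
  continuous f -> continuous g -> continuous (fun x => f x - g x).
Proof. by move=> cf cg x; apply: cvgB; [exact: cf|exact: cg]. Qed.

Lemma continuous_mul (f g : X -> R) :
  continuous f -> continuous g -> continuous (fun x => f x * g x).
Proof. by move=> cf cg x; apply: cvgM; [exact: cf|exact: cg]. Qed.

Lemma continuous_sum (V : normedModType R) (T : finType) (f : T -> X -> V) :
  (forall t, continuous (f t)) -> continuous (fun x => \sum_t f t x).
Proof. by move=> cf; apply: continuous_big => // x; exact: add_continuous. Qed.

Lemma continuous_compose (Y Z : topologicalType) (f : X -> Y) (g : Y -> Z) :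
  continuous f -> continuous g -> continuous (fun x => g (f x)).
Proof. by move=> cf cg x; apply: continuous_comp; [exact: cf|exact: cg]. Qed.

Lemma continuous_const (Y : topologicalType) (y : Y) : continuous (fun _ : X => y).
Proof. by move=> x; exact: cvg_cst. Qed.

End ContinuousCombinations.

(** * The sum rule at a constrained minimum *)

Section SumRule.
Context {R : realType} {n : nat} {T : finType}.
Implicit Types (S : set 'rV[R]_n) (x y z : 'rV[R]_n).

Lemma enorm_sum (F : T -> 'rV[R]_n) : enorm (\sum_t F t) <= \sum_t enorm (F t).
Proof.
elim/big_rec2: _ => [|t a v _ va]; first by rewrite enorm0.
by apply: le_trans (enormD _ _) _; rewrite lerD2l.
Qed.

Lemma common_lipschitz (h : T -> 'rV[R]_n -> R) z :
  (forall t, locally_lipschitz (h t)) ->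
  exists r L, [/\ 0 < r, 0 < L & forall t, lipschitz_with L (eball z r) (h t)].
Proof.
move=> hL; have /choice [p Hp] (t : T) : exists p : R * R,
    [/\ 0 < p.1, 0 < p.2 & lipschitz_with p.2 (eball z p.1) (h t)].
  have [r r0 [K /lipschitz_with_pos [L L0 hl]]] := hL t z.
  by exists (r, L).
exists (\big[Num.min/1]_t (p t).1), (1 + \sum_t (p t).2); split.
- by apply/bigmin_gtP; split=> // t _; have [] := Hp t.
- by rewrite ltr_wpDr // sumr_ge0 // => t _; have [_ /ltW] := Hp t.
- move=> t x y xz yz; have [_ _ H] := Hp t; apply: le_trans (H x y _ _) _.
  + by apply: lt_le_trans xz _; exact: bigmin_le.
  + by apply: lt_le_trans yz _; exact: bigmin_le.
  apply: ler_wpM2r; first exact: enorm_ge0.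
  rewrite (bigD1 t) //= addrCA lerDl addr_ge0 // sumr_ge0 // => s _.
  by have [_ /ltW] := Hp s.
Qed.

Let E := prod_topology (fun _ : option T => 'rV[R]_n).

Lemma dotvv_continuous : continuous (fun x : 'rV[R]_n => dotv x x).
Proof.
have -> : (fun x : 'rV[R]_n => dotv x x) = (fun x => enorm (x - 0) ^+ 2).
  by apply/funext => x; rewrite subr0 enorm_sqr.
move=> x; have c := @enorm_continuous R n 0 x.
exact: (@cvgM _ _ _ (nbhs_filter x) _ _ _ _ c c).
Qed.

Lemma coordinate_continuous (o : option T) : continuous (fun X : E => X o).
Proof. exact: (@proj_continuous _ (fun _ : option T => 'rV[R]_n) o). Qed.

(** Every function gets its own copy X (Some t) of the variable, tied to the
    common point X None by a quadratic penalty, so that optimality can be read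
    off one variable at a time. The last term brings the minimizers to z. *)
Definition decoupled (h : T -> 'rV[R]_n -> R) z (k : R) (X : E) : R :=
  \sum_t (h t (X (Some t)) + k * dotv (X (Some t) - X None) (X (Some t) - X None))
  + dotv (X None - z) (X None - z).

Lemma decoupled_continuous h z (k : R) :
  (forall t, locally_lipschitz (h t)) -> continuous (decoupled h z k).
Proof.
move=> hL; have cc := coordinate_continuous.
apply: (@continuous_add R E R^o).
  apply: (@continuous_sum R E R^o T) => t; apply: (@continuous_add R E R^o).
    apply: (@continuous_compose E 'rV[R]_n R _ (h t) (cc (Some t))).
    exact: locally_lipschitz_continuous.
  apply: (@continuous_mul R E (fun=> k)); first exact: continuous_const.
  apply: (@continuous_compose E 'rV[R]_n R (fun X => X (Some t) - X None)
    (fun x => dotv x x)); last exact: dotvv_continuous.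
  by apply: (@continuous_sub R E); exact: cc.
apply: (@continuous_compose E 'rV[R]_n R (fun X => X None - z)
  (fun x => dotv x x)); last exact: dotvv_continuous.
by apply: (@continuous_sub R E); [exact: cc|exact: continuous_const].
Qed.

End SumRule.

Section SumRuleProof.
Context {R : realType} {n : nat} {T : finType}.
Implicit Types (S : set 'rV[R]_n) (x y z : 'rV[R]_n).

Let E := prod_topology (fun _ : option T => 'rV[R]_n).

Definition decoupled_box S z (r : R) (o : option T) : set 'rV[R]_n :=
  [set y | enorm (y - z) <= r /\ (o = None -> S y)].

Lemma decoupled_min h S z (r k : R) : closed S -> S z -> 0 <= r ->
  (forall t, locally_lipschitz (h t)) ->
  exists X : E, (forall o, decoupled_box S z r o (X o)) /\
    forall Y : E, (forall o, decoupled_box S z r o (Y o)) ->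
      decoupled h z k X <= decoupled h z k Y.
Proof.
move=> clS Sz r0 hL.
pose B := [set X : E | forall o, decoupled_box S z r o (X o)].
have cB : compact B.
  apply: (@tychonoff _ (fun _ : option T => 'rV[R]_n)) => -[t|].
    rewrite (_ : decoupled_box _ _ _ _ = [set y | enorm (y - z) <= r]).
      exact: compact_enorm_le.
    by apply/seteqP; split=> y /= => [[]|].
  rewrite (_ : decoupled_box _ _ _ _ = [set y | enorm (y - z) <= r] `&` S).
    by apply: compact_closedI clS; exact: compact_enorm_le.
  by apply/seteqP; split=> y /= => [[? /(_ erefl)]|[? ?]].
have [||X XB Xmin] := @compact_EVT_min _ R (decoupled h z k) B _ cB.
- by exists (fun=> z) => o /=; split=> //; rewrite subrr enorm0.
- by apply: continuous_subspaceT; exact: decoupled_continuous.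
exists X; split; first by rewrite inE in XB.
by move=> Y YB; apply: Xmin; rewrite inE.
Qed.

Lemma dotvv_sub x y z : dotv (y - x) (y - x) =
  dotv (z - x) (z - x) + 2 * dotv (z - x) (y - z) + dotv (y - z) (y - z).
Proof.
have -> : y - x = (z - x) + (y - z) by rewrite [RHS]addrC addrA subrK.
by move: (z - x) (y - z) => a b; rewrite dotvDl !dotvDr (dotvC b a); ring.
Qed.

Lemma enorm_lt_ball x y z (a b : R) :
  enorm (y - x) < a -> enorm (x - z) <= b -> enorm (y - z) < a + b.
Proof. by move=> yx xz; apply: le_lt_trans (enorm_triangle x y z) _; rewrite ltr_leD. Qed.

Section Minimizer.
Variables (h : T -> 'rV[R]_n -> R) (S : set 'rV[R]_n) (z : 'rV[R]_n) (r k L : R).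
Hypotheses (Sz : S z) (r0 : 0 < r) (k0 : 0 < k) (L0 : 0 < L).
Hypothesis hL : forall t, lipschitz_with L (eball z (r + r)) (h t).
Hypothesis zmin : forall x, S x -> \sum_t h t z <= \sum_t h t x.
Variable X : E.
Hypothesis XB : forall o, decoupled_box S z r o (X o).
Hypothesis Xmin : forall Y : E, (forall o, decoupled_box S z r o (Y o)) ->
  decoupled h z k X <= decoupled h z k Y.

Let x := X None.
Let u t := X (Some t).

Let xz : enorm (x - z) <= r. Proof. by have [] := XB None. Qed.
Let Sx : S x. Proof. by have [_ /(_ erefl)] := XB None. Qed.
Let uz t : enorm (u t - z) <= r. Proof. by have [] := XB (Some t). Qed.

(** Move one copy only. *)
Let copy_opt t y : enorm (y - z) <= r ->
  h t (u t) + k * dotv (u t - x) (u t - x) <= h t y + k * dotv (y - x) (y - x).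
Proof.
move=> yz; pose Y : E := fun o => if o == Some t then y else X o.
have /Xmin : forall o, decoupled_box S z r o (Y o).
  by move=> o; rewrite /Y; case: eqP => [->|_].
rewrite /decoupled /Y /= lerD2r (bigD1 t) //= [leRHS](bigD1 t) //= eqxx.
rewrite (eq_bigr (fun s => h s (u s) + k * dotv (u s - x) (u s - x))) //.
rewrite [X in _ <= _ + X](eq_bigr (fun s => h s (u s) + k * dotv (u s - x) (u s - x))).
  by rewrite lerD2r.
move=> s st; have -> // : (Some s == Some t) = false.
by apply/negbTE; apply: contra st => /eqP[->].
Qed.

(** Move the point of S only. *)
Let base_opt y : S y -> enorm (y - z) <= r ->
  \sum_t k * dotv (u t - x) (u t - x) + dotv (x - z) (x - z) <=
  \sum_t k * dotv (u t - y) (u t - y) + dotv (y - z) (y - z).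
Proof.
move=> Sy yz; pose Y : E := fun o => if o is Some t then u t else y.
have /Xmin : forall o, decoupled_box S z r o (Y o).
  by case=> [t|]; rewrite /Y //=; split.
by rewrite /decoupled /Y /= !big_split /= -!addrA lerD2l.
Qed.

(** Compare with the copy t placed at x itself. *)
Lemma copy_dist t : k * enorm (u t - x) <= L.
Proof.
have := copy_opt t xz; rewrite subrr dotv0 mulr0 addr0 -enorm_sqr => H.
have sub y : enorm (y - z) <= r -> eball z (r + r) y.
  by move=> yz; rewrite /eball /=; apply: le_lt_trans yz _; rewrite ltrDl.
have /ler_normlP [+ _] := hL t (sub _ (uz t)) (sub _ xz).
have := enorm_ge0 (u t - x); rewrite le_eqVlt => /predU1P[<- _|a0 hl].
  by rewrite mulr0 ltW.
by rewrite -(ler_pM2r a0); move: H hl; rewrite expr2; lra.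
Qed.

(** Compare with the diagonal point (z, ..., z), then use that z is minimal. *)
Lemma base_dist : k * enorm (x - z) ^+ 2 <= #|T|%:R * L ^+ 2.
Proof.
have sub y : enorm (y - z) <= r -> eball z (r + r) y.
  by move=> yz; rewrite /eball /=; apply: le_lt_trans yz _; rewrite ltrDl.
have zB o : decoupled_box S z r o z by split=> //; rewrite subrr enorm0 ltW.
have := @Xmin (fun=> z) zB; rewrite /decoupled subrr dotv0 addr0.
under [leRHS]eq_bigr do rewrite mulr0 addr0.
move/le_trans => /(_ _ (zmin Sx)); rewrite -enorm_sqr.
have hx : \sum_t h t x <= \sum_t (h t (u t) + L * (L / k)).
  apply: ler_sum => t _; have /ler_normlP [+ _] := hL t (sub _ (uz t)) (sub _ xz).
  have aL : enorm (u t - x) <= L / k by rewrite ler_pdivlMr // mulrC copy_dist.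
  by have := ler_wpM2l (ltW L0) aL; lra.
have hu : \sum_t h t (u t) <=
    \sum_t (h t (u t) + k * dotv (u t - x) (u t - x)).
  by apply: ler_sum => t _; rewrite lerDl mulr_ge0 ?dotvv_ge0 // ltW.
rewrite big_split /= sumr_const -mulr_natl in hx => hz.
have : enorm (x - z) ^+ 2 <= #|T|%:R * (L * (L / k)) by rewrite /x in hx hu *; lra.
by rewrite -(ler_pM2l k0) => /le_trans; apply; rewrite le_eqVlt; apply/orP; left;
  apply/eqP; field; rewrite gt_eqF.
Qed.

Let v t := (2 * k) *: (x - u t).

(** The penalty is quadratic in the copy, so its gradient is a proximal
    subgradient of the function that it balances. *)
Lemma copy_prox t : enorm (u t - z) < r -> prox_subgrad (h t) (u t) (v t).
Proof.
move=> utz; exists k, (r - enorm (u t - z)); split=> //; first by rewrite subr_gt0.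
move=> y yu; have yz : enorm (y - z) <= r.
  by have := enorm_lt_ball yu (lexx (enorm (u t - z))); rewrite subrK => /ltW.
have := copy_opt t yz; rewrite (dotvv_sub x y (u t)) /v dotvZl.
have -> : dotv (x - u t) (y - u t) = - dotv (u t - x) (y - u t).
  by rewrite -dotvNl opprB.
lra.
Qed.

(** The normal balances the gradients of all penalties, up to the last term of
    the decoupled function, which is small. *)
Lemma base_prox : enorm (x - z) < r ->
  prox_normal S x (- (2 *: (x - z)) - \sum_t v t).
Proof.
move=> xzr; split=> //; exists (1 + #|T|%:R * k), (r - enorm (x - z)).
split; first by rewrite ltr_wpDr // mulr_ge0 // ltW.
  by rewrite subr_gt0.
move=> y Sy yx; have yz : enorm (y - z) <= r.
  by have := enorm_lt_ball yx (lexx (enorm (x - z))); rewrite subrK => /ltW.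
have := base_opt Sy yz; rewrite (dotvv_sub z y x).
have -> : dotv (- (2 *: (x - z)) - \sum_t v t) (y - x) =
    - (2 * dotv (x - z) (y - x)) - \sum_t dotv (v t) (y - x).
  by move: (x - z) (y - x) => a b; rewrite dotvDl !dotvNl dotvZl dotv_suml.
have -> : \sum_t k * dotv (u t - y) (u t - y) =
    \sum_t k * dotv (u t - x) (u t - x) + \sum_t dotv (v t) (y - x)
    + #|T|%:R * k * dotv (y - x) (y - x).
  rewrite -mulrA mulr_natl -sumr_const -!big_split /=; apply: eq_bigr => t _.
  rewrite -[u t - y]opprB dotvNl dotvNr opprK (dotvv_sub (u t) y x) /v dotvZl.
  by rewrite -[u t - x]opprB dotvNl dotvNr opprK; ring.
lra.
Qed.

End Minimizer.

(** As the penalty factor k grows the minimizers tend to z, and what is left of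
    the sum of the subgradients and the normal is - 2 (x - z). *)
Lemma fuzzy_sum_rule (h : T -> 'rV[R]_n -> R) S z (e : R) :
  closed S -> S z -> (forall t, locally_lipschitz (h t)) ->
  (forall x, S x -> \sum_t h t z <= \sum_t h t x) -> 0 < e ->
  exists x (u v : T -> 'rV[R]_n) s,
    [/\ enorm (x - z) < e, forall t, enorm (u t - z) < e,
        forall t, prox_subgrad (h t) (u t) (v t), prox_normal S x s
      & enorm (s + \sum_t v t) < e].
Proof.
move=> clS Sz hL zmin e0; have [q [L [q0 L0 qL]]] := common_lipschitz z hL.
pose r := q / 2; have r0 : 0 < r by rewrite divr_gt0.
pose d := Num.min e r / 2.
have d0 : 0 < d by rewrite divr_gt0 // lt_min e0.
have [de dr] : d + d <= e /\ d + d <= r.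
  by rewrite /d -splitr ge_min lexx ge_min lexx orbT.
(* both L / k < d and #|T| L^2 / k < d^2 *)
pose k := 1 + L / d + #|T|%:R * L ^+ 2 / d ^+ 2.
have Ld : 0 <= L / d by rewrite divr_ge0 // ltW.
have NLd : 0 <= #|T|%:R * L ^+ 2 / d ^+ 2.
  by rewrite !mulr_ge0 ?invr_ge0 ?exprn_ge0 // ltW.
have k0 : 0 < k by rewrite /k; lra.
have kL : L < k * d by rewrite -ltr_pdivrMr // /k; lra.
have kL2 : #|T|%:R * L ^+ 2 < k * d ^+ 2.
  by rewrite -ltr_pdivrMr ?exprn_gt0 // /k; lra.
have [X [XB Xmin]] := @decoupled_min h S z r k clS Sz (ltW r0) hL.
have qL' t : lipschitz_with L (eball z (r + r)) (h t) by rewrite /r -splitr.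
have ud t : enorm (X (Some t) - X None) < d.
  rewrite -(ltr_pM2l k0); apply: le_lt_trans kL.
  exact: (copy_dist r0 L0 qL' XB Xmin).
have xd : enorm (X None - z) < d.
  rewrite -(@ltr_pXn2r _ 2) ?nnegrE ?enorm_ge0 ?(ltW d0) // -(ltr_pM2l k0).
  apply: le_lt_trans kL2; exact: (base_dist Sz r0 k0 L0 qL' zmin XB Xmin).
have uz t : enorm (X (Some t) - z) < d + d by apply: enorm_lt_ball (ud t) (ltW xd).
have xr : enorm (X None - z) < r by apply: lt_le_trans dr; rewrite ltr_wpDr // ltW.
exists (X None), (fun t => X (Some t)), (fun t => (2 * k) *: (X None - X (Some t))).
exists (- (2 *: (X None - z)) - \sum_t (2 * k) *: (X None - X (Some t))); split.
- by apply: lt_le_trans de; rewrite ltr_wpDr // ltW.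
- by move=> t; exact: lt_le_trans (uz t) de.
- move=> t; apply: (copy_prox k0 XB Xmin); exact: lt_le_trans (uz t) dr.
- exact: (base_prox k0 XB Xmin).
- rewrite subrK enormN enormZ gtr0_norm //; apply: lt_le_trans de.
  by rewrite mulrDl !mul1r ltrD.
Qed.

(** The bounded fuzzy subgradients accumulate, jointly in the index. *)
Theorem sum_rule (h : T -> 'rV[R]_n -> R) S z :
  closed S -> S z -> (forall t, locally_lipschitz (h t)) ->
  (forall x, S x -> \sum_t h t z <= \sum_t h t x) ->
  exists2 v : T -> 'rV[R]_n, forall t, prox_limsub (h t) z (v t)
    & prox_limnormal S z (- \sum_t v t).
Proof.
move=> clS Sz hL zmin; have [q [L [q0 L0 qL]]] := common_lipschitz z hL.
pose F := prod_topology (fun _ : T => 'rV[R]_n).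
pose K := [set v : F | forall t, [set y | enorm (y - 0) <= L] (v t)].
pose A (e : R) := [set v : F | K v /\ exists x (u : T -> 'rV[R]_n) s,
    [/\ enorm (x - z) < e, forall t, enorm (u t - z) < e,
        forall t, prox_subgrad (h t) (u t) (v t), prox_normal S x s
      & enorm (s + \sum_t v t) < e]].
have cK : compact K.
  exact: (@tychonoff _ (fun _ : T => 'rV[R]_n) _ (fun=> @compact_enorm_le R n 0 L)).
have [||d e de|v Kv clv] := @compact_accumulation R F K A cK.
- move=> e e0; have [|x [u [v [s [xz uz uv xs sv]]]]] :=
      @fuzzy_sum_rule h S z (Num.min e (q / 2)) clS Sz hL zmin.
    by rewrite lt_min e0 divr_gt0.
  exists v; split=> [t /=|].
    rewrite subr0; apply: (@prox_subgrad_lipschitz _ _ (h t) (u t) _ (q / 2)) => //.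
    + by rewrite divr_gt0.
    + exact: ltW.
    have sub y : eball (u t) (q / 2) y -> eball z q y.
      move=> yu; have := uz t; rewrite lt_min => /andP[_ /ltW].
      by move/(enorm_lt_ball yu); rewrite -splitr.
    by move=> y y' /sub yz /sub; exact: qL.
  exists x, u, s; split=> //; first by move: xz; rewrite lt_min => /andP[].
    by move=> t; have := uz t; rewrite lt_min => /andP[].
  by move: sv; rewrite lt_min => /andP[].
- by move=> e e0 v [].
- move=> v [Kv [x [u [s [xz uz uv xs sv]]]]]; split=> //; exists x, u, s.
  split=> //; first exact: lt_le_trans de.
    by move=> t; exact: lt_le_trans de.
  exact: lt_le_trans de.
have near_v (e : R) : 0 < e -> nbhs v [set w : F | forall t, enorm (w t - v t) < e].
  move=> e0; apply: (@filter_forall F T (fun t w => enorm (w t - v t) < e) _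
    (nbhs_filter v)) => t.
  apply: (@proj_continuous T (fun _ : T => 'rV[R]_n) t v (eball (v t) e)).
  exact: nbhs_eball.
exists v => [t|] e e0.
  have [w [[Kw [x [u [s [xz uz uv xs sv]]]]] wv]] := clv _ _ e0 (near_v e e0).
  by exists (u t), (w t); split.
pose N : R := #|T|.+1%:R; have N0 : 0 < N by [].
have eN : 0 < e / (N + 1) by rewrite divr_gt0 ?addr_gt0.
have [w [[Kw [x [u [s [xz uz uv xs sv]]]]] wv]] := clv _ _ eN (near_v _ eN).
have le_eN : e / (N + 1) <= e.
  by rewrite ler_pdivrMr ?addr_gt0 // ler_peMr ?(ltW e0) // lerDr ltW.
exists x, s; split=> //; first exact: lt_le_trans le_eN.
rewrite opprK (_ : _ + _ = s + \sum_t w t + \sum_t (v t - w t)); last first.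
  by rewrite -addrA -big_split /=; congr (_ + _); apply: eq_bigr => t _; rewrite addrC subrK.
apply: le_lt_trans (enormD _ _) _.
have : \sum_t enorm (v t - w t) <= \sum_(t : T) e / (N + 1).
  by apply: ler_sum => t _; rewrite enormB ltW.
rewrite sumr_const -mulr_natl => H; have := le_trans (enorm_sum _) H.
have : e = e / (N + 1) * (N + 1) by rewrite divfK // gt_eqF // addr_gt0.
have : #|T|%:R < N by rewrite ltr_nat.
rewrite -(ltr_pM2r eN); lra.
Qed.

End SumRuleProof.

(** * The mean value inequality *)

Section MeanValue.
Context {R : realType} {n : nat}.
Implicit Types (h : 'rV[R]_n -> R) (x y z a w l : 'rV[R]_n).

Lemma le0_of_small (a b t0 : R) : 0 < t0 ->
  (forall t, 0 < t -> t <= t0 -> a <= t * b) -> a <= 0.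
Proof.
move=> t00 H; rewrite leNgt; apply/negP => a0.
have b0 : 0 < b.
  by have := H _ t00 (lexx _) => /(lt_le_trans a0); rewrite pmulr_rgt0.
have := H (Num.min t0 (a / b / 2)); rewrite lt_min t00 ge_min lexx !divr_gt0 //.
move=> /(_ isT isT); apply/negP; rewrite -ltNge.
apply: (@le_lt_trans _ _ (a / b / 2 * b)).
  by rewrite ler_pM2r // ge_min lexx orbT.
by rewrite mulrAC divfK ?gt_eqF // ltr_pdivrMr // ltr_pMr // ltr1n.
Qed.

Lemma dotv_lipschitz l x y : `|dotv l x - dotv l y| <= enorm l * enorm (x - y).
Proof.
rewrite -dotvNr -dotvDr ler_norml cauchy_schwarz andbT lerNl -dotvNl.
by rewrite -(enormN l) cauchy_schwarz.
Qed.

Lemma locally_lipschitz_linear h l : locally_lipschitz h ->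
  locally_lipschitz (fun y => h y - dotv l y).
Proof.
move=> hL x; have [r r0 [K hK]] := hL x; exists r => //; exists (K + enorm l).
move=> y y' xy xy'; rewrite mulrDl.
have -> : h y - dotv l y - (h y' - dotv l y') = h y - h y' - (dotv l y - dotv l y').
  by ring.
by rewrite (le_trans (ler_normB _ _)) // lerD ?hK // dotv_lipschitz.
Qed.

(** Every function is minimal at z over the singleton of z. *)
Lemma prox_limsub_nonempty h z : locally_lipschitz h -> prox_limsub h z !=set0.
Proof.
move=> hL; have [||t|x ->|v hv _] := @sum_rule R n 'I_1 (fun=> h) [set z] z => //.
  apply: compact_closed; [exact: norm_hausdorff|exact: compact_set1].
by exists (v 0).
Qed.

Definition segment a w : set 'rV[R]_n :=
  [set a + s *: w | s in [set s : R | 0 <= s <= 1]].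

Lemma segment_continuous a w : continuous (fun s : R => a + s *: w).
Proof.
move=> s; apply: cvgD; first exact: cvg_cst.
by apply: cvgZr_tmp; exact: cvg_id.
Qed.

Lemma closed_segment a w : closed (segment a w).
Proof.
apply: compact_closed; first exact: norm_hausdorff.
apply: continuous_compact.
  by apply: continuous_subspaceT; exact: segment_continuous.
rewrite (_ : [set s | _] = `[0, 1]%classic); first exact: segment_compact.
by apply/seteqP; split=> s /=; rewrite in_itv.
Qed.

(** Away from its far end, a segment contains a forward step along w. *)
Lemma segment_normal a w (s : R) v : w <> 0 -> 0 <= s -> s < 1 ->
  prox_limnormal (segment a w) (a + s *: w) v -> dotv v w <= 0.
Proof.
move=> w0 s0 s1 nv; have pw := enorm_gt0 w0.
apply/ler_addgt0Pr => e e0; rewrite add0r.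
have [|x [u [xz uv [[t /andP[t0 _] xE] [k [r [k0 r0 H]]]]]]] :=
    nv (Num.min ((1 - s) * enorm w) (e / enorm w)).
  by rewrite lt_min !(divr_gt0, mulr_gt0) // subr_gt0.
rewrite -{}xE in xz H; move: xz; rewrite lt_min => /andP[xs _].
have t1 : t < 1.
  move: xs; rewrite opprD addrACA subrr add0r -scalerBl enormZ ltr_pM2r // => xs.
  by have := ler_norm (t - s); lra.
move: uv; rewrite lt_min ltr_pdivlMr // => /andP[_ uv].
have u0 : dotv u w <= 0.
  pose t1' := Num.min (1 - t) (r / 2 / enorm w).
  apply: (@le0_of_small _ (k * dotv w w) t1') => [|d d0 dt].
    by rewrite lt_min subr_gt0 t1 !divr_gt0.
  move: dt; rewrite le_min ler_pdivlMr // => /andP[dt dr].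
  have xd : a + (t + d) *: w - (a + t *: w) = d *: w.
    by rewrite opprD addrACA subrr add0r -scalerBl addrAC subrr add0r.
  have := H (a + (t + d) *: w); rewrite xd enormZ gtr0_norm //.
  have Hs : segment a w (a + (t + d) *: w).
    by exists (t + d) => //=; rewrite addr_ge0 ?(ltW d0) //=; lra.
  move=> /(_ Hs); have -> : d * enorm w < r.
    by apply: le_lt_trans dr _; rewrite ltr_pdivrMr // ltr_pMr // ltr1n.
  move=> /(_ isT); rewrite dotvZr dotvZl dotvZr => Hd.
  by rewrite -(ler_pM2l d0); lra.
have := cauchy_schwarz (v - u) w; rewrite dotvDl dotvNl enormB; lra.
Qed.

(** At a minimum along the segment of h minus its secant, the sum rule leaves the
    slope of the secant and a normal. The two ends have equal values, so the
    minimum can be taken away from the far end. *)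
Lemma mean_value h a w : locally_lipschitz h -> w <> 0 ->
  exists s v, [/\ 0 <= s <= 1, prox_limsub h (a + s *: w) v
                & h (a + w) - h a <= dotv v w].
Proof.
move=> hL w0; have pw := enorm_gt0 w0.
pose m := h (a + w) - h a; pose l := (m / dotv w w) *: w.
have lw : dotv l w = m by rewrite dotvZl divfK // -enorm_sqr expf_neq0 // gt_eqF.
pose H y := h y - dotv l y.
have HL : locally_lipschitz H by exact: locally_lipschitz_linear.
have Hends : H (a + 1 *: w) = H (a + 0 *: w).
  by rewrite /H scale1r scale0r addr0 dotvDr lw /m; ring.
have [s /andP[s0 s1] smin] : exists2 s : R, 0 <= s < 1 &
    forall t, 0 <= t <= 1 -> H (a + s *: w) <= H (a + t *: w).
  have [|s] := @EVT_min R (fun s => H (a + s *: w)) 0 1 ler01.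
    apply: continuous_subspaceT.
    exact: (continuous_compose (@segment_continuous a w)
      (locally_lipschitz_continuous HL)).
  rewrite in_itv /= => /andP[s0]; rewrite le_eqVlt => /predU1P[s1|s1] smin.
    exists 0; first by rewrite lexx ltr01.
    by move=> t t01; rewrite -Hends -s1; apply: smin; rewrite in_itv.
  by exists s; [rewrite s0|move=> t t01; apply: smin; rewrite in_itv].
have [||x [t t01 <-]|v Hv nv] :=
    @sum_rule R n 'I_1 (fun=> H) (segment a w) (a + s *: w) (@closed_segment a w).
- by exists s => //=; rewrite s0 ltW.
- by [].
- by rewrite !big_ord1; exact: smin.
exists s, (v 0 + l); split; first by rewrite s0 ltW.
  by apply: prox_limsub_linear; exact: Hv.
have := segment_normal w0 s0 s1 nv; rewrite big_ord1 dotvDl lw dotvNl /m; lra.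
Qed.

End MeanValue.

(** * Subgradients of the robust constraint function *)

Section MaxFunction.
Context {R : realType} {n p : nat} {q : 'I_p -> nat}.
Unset Implicit Arguments.
Variables (V : forall j, set 'rV[R]_(q j)).
Variables (g : forall j, 'rV[R]_n -> 'rV[R]_(q j) -> R).
Variable j : 'I_p.
Hypotheses (V0 : V j !=set0) (cV : compact (V j)).
Hypothesis cond : constraint_conditions V g.
Set Implicit Arguments.

Let G := gmax V g j.

Lemma active_nonempty x : active V g j x !=set0.
Proof.
have [d d0 [[usc _] _]] := cond x j.
have [v Vv vmax] : exists2 v, V j v & forall w, V j w -> g j x w <= g j x v.
  by apply: compact_usc_max => //; apply: usc; rewrite /eball /= subrr enorm0.
exists v; split=> //; apply/eqP; rewrite eq_le; apply/andP; split.
  by apply: ub_le_sup; [exists (g j x v) => _ [w Vw <-]; exact: vmax|exists v].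
by apply: ge_sup; [exists (g j x v), v|move=> _ [w Vw <-]; exact: vmax].
Qed.

Lemma le_gmax x v : V j v -> g j x v <= G x.
Proof.
move=> Vv; have [d d0 [[usc _] _]] := cond x j.
have [w Vw wmax] : exists2 v, V j v & forall w, V j w -> g j x w <= g j x v.
  by apply: compact_usc_max => //; apply: usc; rewrite /eball /= subrr enorm0.
by apply: ub_le_sup; [exists (g j x w) => _ [u Vu <-]; exact: wmax|exists v].
Qed.

Lemma constraint_lipschitz z : exists d K, [/\ 0 < d, 0 < K,
  forall v, V j v -> lipschitz_with K (eball z d) (fun x => g j x v)
  & lipschitz_with K (eball z d) G].
Proof.
have [d d0 [[_ [K0 gK0]] _]] := cond z j; pose K := `|K0| + 1.
have gK v : V j v -> lipschitz_with K (eball z d) (fun x => g j x v).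
  move=> Vv x y xz yz; apply: le_trans (gK0 v Vv x y xz yz) _.
  by apply: ler_wpM2r; rewrite ?enorm_ge0 // ler_wpDr // ler_norm.
exists d, K; split=> //; first by rewrite ltr_wpDl.
have half x y : eball z d x -> eball z d y -> G x - G y <= K * enorm (x - y).
  move=> xz yz; have [v [Vv vx]] := active_nonempty x; rewrite -/(G x) in vx.
  have /ler_normlP [_ +] := gK v Vv x y xz yz.
  by have := le_gmax y Vv; lra.
move=> x y xz yz; rewrite ler_norml half // andbT lerNl opprB enormB.
exact: half.
Qed.

Lemma gmax_locally_lipschitz : locally_lipschitz G.
Proof.
by move=> z; have [d [K [d0 _ _ GK]]] := constraint_lipschitz z; exists d => //; exists K.
Qed.

Lemma constraint_locally_lipschitz v :
  V j v -> locally_lipschitz (fun x => g j x v).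
Proof.
move=> Vv z; have [d [K [d0 _ gK _]]] := constraint_lipschitz z.
by exists d => //; exists K; exact: gK.
Qed.

(** Nearly active parameters accumulate at an active one, by compactness and
    upper semicontinuity; the closedness condition then passes to the limit in
    the subgradients. *)
Lemma active_limit z c :
  (forall e, 0 < e -> exists x v c', [/\ enorm (x - z) < e, V j v,
      G z - e < g j z v, limsub (fun y => g j y v) x c' & enorm (c' - c) < e]) ->
  exists2 v, active V g j z v & limsub (fun y => g j y v) z c.
Proof.
move=> H; have [d d0 [[usc _] clz]] := cond z j.
pose A e := [set v | V j v /\ G z - e < g j z v /\ exists x c',
  [/\ enorm (x - z) < e, limsub (fun y => g j y v) x c' & enorm (c' - c) < e]].
have [|||v Vv clv] := @compact_accumulation R _ (V j) A cV.
- move=> e /H [x [v [c' [xz Vv zv xc' c'c]]]]; exists v; split=> //; split=> //.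
  by exists x, c'.
- by move=> e e0 v [].
- move=> a b ab v [Vv [zv [x [c' [xz xc' c'c]]]]]; split=> //; split.
    by apply: le_lt_trans zv; rewrite lerD2l lerN2.
  by exists x, c'; split=> //; exact: lt_le_trans ab.
have Gv : g j z v = G z.
  apply/eqP; rewrite eq_le le_gmax //= leNgt; apply/negP => vG.
  have e0 : 0 < (G z - g j z v) / 2 by rewrite divr_gt0 // subr_gt0.
  have zz : eball z d z by rewrite /eball /= subrr enorm0.
  have vc : g j z v < G z - (G z - g j z v) / 2 by lra.
  have [w [[Vw [zw _]] /(_ Vw)]] := clv _ _ e0 (usc z zz v Vv _ vc).
  by rewrite ltNge ltW.
exists v; first by split.
have e0 k : 0 < Num.min d k.+1%:R^-1 by rewrite lt_min d0 invr_gt0 ltr0n.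
have /choice [w Hw] (k : nat) : exists w : 'rV[R]_(q j) * ('rV[R]_n * 'rV[R]_n),
    [/\ V j w.1, limsub (fun y => g j y w.1) w.2.1 w.2.2,
        enorm (w.2.1 - z) < Num.min d k.+1%:R^-1, enorm (w.2.2 - c) < k.+1%:R^-1
      & enorm (w.1 - v) < k.+1%:R^-1].
  have k0 : 0 < k.+1%:R^-1 :> R by rewrite invr_gt0 ltr0n.
  have [w [[Vw [_ [x [c' [xz xc' c'c]]]]] wv]] := clv _ _ (e0 k) (nbhs_eball v k0).
  exists (w, (x, c')); split=> //.
  by apply: lt_le_trans c'c _; rewrite ge_min lexx orbT.
apply: (clz v _ (fun k => (w k).2.1) (fun k => (w k).1) (fun k => (w k).2.2)).
- by split.
- move=> k; have [_ _ + _ _] := Hw k; rewrite lt_min => /andP[+ _]; exact.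
- by move=> k; have [] := Hw k.
- by move=> k; have [] := Hw k.
- by apply: cvg_enorm => k; have [_ _ + _ _] := Hw k; rewrite lt_min => /andP[].
- by apply: cvg_enorm => k; have [] := Hw k.
- by apply: cvg_enorm => k; have [] := Hw k.
Qed.

Section AtPoint.
Variables (z : 'rV[R]_n) (d K : R).
Hypotheses (d0 : 0 < d) (K0 : 0 < K).
Hypothesis gK : forall v, V j v -> lipschitz_with K (eball z d) (fun x => g j x v).
Hypothesis GK : lipschitz_with K (eball z d) G.

(** The bound makes this set compact; the subgradients that the mean value
    inequality produces satisfy it. *)
Definition bounded_active_subgrad : set 'rV[R]_n :=
  [set c | enorm (c - 0) <= K /\
    exists2 v, active V g j z v & limsub (fun y => g j y v) z c].

Lemma bounded_active_subgrad_compact : compact bounded_active_subgrad.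
Proof.
rewrite (_ : bounded_active_subgrad = [set c | enorm (c - 0) <= K] `&`
    [set c | exists2 v, active V g j z v & limsub (fun y => g j y v) z c]) //.
apply: compact_closedI; first exact: compact_enorm_le.
move=> c clc; apply: active_limit => e e0.
have [c' [[v [Vv vG] zc'] c'c]] := clc _ (nbhs_eball c e0).
exists z, v, c'; split=> //; first by rewrite subrr enorm0.
by rewrite vG ltrBlDr ltrDl.
Qed.

Lemma bounded_active_subgrad_nonempty : bounded_active_subgrad !=set0.
Proof.
have [v av] := active_nonempty z; have [Vv _] := av.
have [c cz] := prox_limsub_nonempty z (constraint_locally_lipschitz Vv).
exists c; split.
  by rewrite subr0; apply: prox_limsub_lipschitz (gK Vv) cz => //; exact: ltW.
exists v => //; apply: prox_limsub_sub cz.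
exact/locally_lipschitz_continuous/constraint_locally_lipschitz.
Qed.

(** Step from x to x + t w: the maximum grows by at least its subgradient in
    the direction w, and so does g(., v) for v active at the far end, to which
    the mean value inequality applies. *)
Lemma max_subgrad_nearby u w : prox_limsub G z u -> w <> 0 ->
  forall e, 0 < e -> exists x v c, [/\ enorm (x - z) < e /\ V j v, G z - e < g j z v,
    limsub (fun y => g j y v) x c, enorm (c - 0) <= K
    & dotv u w - e <= dotv c w].
Proof.
move=> zu w0 e e0; have pw := enorm_gt0 w0.
(* the errors below are 4 K s, (1 + enorm w) s and 2 s, each at most e *)
pose N := 4 * K + enorm w + 3.
have N0 : 0 < N by rewrite /N; have := K0; have := pw; lra.
pose s := Num.min (d / 4) (e / N).
have s0 : 0 < s by rewrite lt_min !divr_gt0.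
have sd : s + s + d / 2 <= d.
  have : s <= d / 4 by rewrite ge_min lexx.
  by lra.
have sN : s * (4 * K + enorm w + 3) <= e.
  by rewrite -ler_pdivlMr // ge_min lexx orbT.
have sK := mulr_gt0 s0 K0; have sw := mulr_gt0 s0 pw.
have [x [u' [xz u'u [k [r [k0 r0 H]]]]]] := zu s s0.
pose t := Num.min (Num.min r s / 2 / enorm w) (s / (k * dotv w w)).
have ww : 0 < dotv w w by rewrite -enorm_sqr exprn_gt0.
have t0 : 0 < t by rewrite lt_min !divr_gt0 ?mulr_gt0 // lt_min r0.
have [tr ts] : t * enorm w < r /\ t * enorm w < s.
  have : t * enorm w < Num.min r s.
    apply: (@le_lt_trans _ _ (Num.min r s / 2)).
      by rewrite -ler_pdivlMr // ge_min lexx.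
    by rewrite ltr_pdivrMr // ltr_pMr ?ltr1n // lt_min r0.
  by rewrite lt_min => /andP[].
have tk : t * (k * dotv w w) <= s.
  by rewrite -ler_pdivlMr ?mulr_gt0 // ge_min lexx orbT.
have ntw : enorm (t *: w) = t * enorm w by rewrite enormZ gtr0_norm.
pose y := x + t *: w; have yx : y - x = t *: w by rewrite /y addrC addKr.
have yz : enorm (y - z) < s + s.
  by apply: enorm_lt_ball (ltW xz); rewrite yx ntw.
have [v [Vv vy]] := active_nonempty y.
have tw0 : t *: w <> 0.
  by move=> tw0; move: ntw; rewrite tw0 enorm0; have := mulr_gt0 t0 pw; lra.
have [a [c [/andP[a0 a1] xc gc]]] :=
  mean_value x (constraint_locally_lipschitz Vv) tw0.
have az : enorm (x + a *: (t *: w) - z) < s + s.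
  apply: enorm_lt_ball (ltW xz); rewrite [x + _]addrC addrK enormZ ger0_norm // ntw.
  by apply: le_lt_trans ts; rewrite ler_piMl // mulr_ge0 // ltW.
exists (x + a *: (t *: w)), v, c; split=> //.
- split=> //; apply: lt_le_trans az _; lra.
- have /ler_normlP [_ Gyz] : `|G z - G y| <= K * (s + s).
    apply: (@le_trans _ _ (K * enorm (z - y))).
      apply: GK; first by rewrite /eball /= subrr enorm0.
      by rewrite /eball /=; apply: lt_le_trans yz _; lra.
    by rewrite enormB ler_pM2l // ltW.
  have /ler_normlP [+ _] : `|g j z v - g j y v| <= K * (s + s).
    apply: (@le_trans _ _ (K * enorm (z - y))).
      apply: gK => //; first by rewrite /eball /= subrr enorm0.
      by rewrite /eball /=; apply: lt_le_trans yz _; lra.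
    by rewrite enormB ler_pM2l // ltW.
  by rewrite vy -/G; lra.
- apply: prox_limsub_sub xc.
  exact/locally_lipschitz_continuous/constraint_locally_lipschitz.
- rewrite subr0; apply: (@prox_limsub_lipschitz _ _ _ _ _ (d / 2) K _ _ _ xc).
  + by rewrite divr_gt0.
  + exact: ltW.
  have sub y' : eball (x + a *: (t *: w)) (d / 2) y' -> eball z d y'.
    move=> yc; have := enorm_lt_ball yc (ltW az).
    by move/lt_le_trans; apply; lra.
  by move=> y1 y2 /sub y1z /sub; exact: gK.
- have := H y; rewrite yx ntw => /(_ tr); rewrite !dotvZr !dotvZl in gc *.
  rewrite -/y vy -/G in gc; have := le_gmax x Vv => gx Hy.
  have t_u' : dotv u' w - s <= dotv c w.
    by rewrite -(ler_pM2l t0); have := ler_wpM2l (ltW t0) tk; lra.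
  have := cauchy_schwarz (u - u') w; rewrite dotvDl dotvNl enormB => uu'.
  have : enorm (u' - u) * enorm w <= s * enorm w by rewrite ler_pM2r // ltW.
  by move: sN; lra.
Qed.

Lemma max_subgrad_direction u w : prox_limsub G z u -> w <> 0 ->
  exists2 c, bounded_active_subgrad c & dotv u w <= dotv c w.
Proof.
move=> zu w0; have pw := enorm_gt0 w0; have near_u := max_subgrad_nearby zu w0.
pose A e := [set c : 'rV[R]_n | [/\ enorm (c - 0) <= K, dotv u w - e <= dotv c w
  & exists x v, [/\ enorm (x - z) < e, V j v, G z - e < g j z v
                  & limsub (fun y => g j y v) x c]]].
have [|||c cK clc] := @compact_accumulation R _ _ A (@compact_enorm_le R n 0 K).
- move=> e /near_u [x [v [c [[xz Vv] zv xc cK cw]]]]; exists c; split=> //.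
  by exists x, v.
- by move=> e e0 c [].
- move=> a b ab c [cK cw [x [v [xz Vv zv xc]]]]; split=> //; first by lra.
  by exists x, v; split=> //; [exact: lt_le_trans ab|lra].
exists c; first split=> //.
  apply: active_limit => e e0.
  have [c' [[_ _ [x [v [xz Vv zv xc]]]] c'c]] := clc _ _ e0 (nbhs_eball c e0).
  by exists x, v, c'.
apply/ler_addgt0Pr => e e0; have e20 : 0 < e / 2 by rewrite divr_gt0.
have e2w : 0 < e / 2 / enorm w by rewrite divr_gt0.
have [c' [[_ c'w _] c'c]] := clc _ _ e20 (nbhs_eball c e2w).
have := cauchy_schwarz (c' - c) w; rewrite dotvDl dotvNl.
by move: c'c; rewrite /eball /= ltr_pdivlMr //; lra.
Qed.

End AtPoint.
End MaxFunction.

(** * Convex hulls of compact sets *)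

Section ConvexHull.
Context {R : realType} {n : nat}.
Implicit Types (C : set 'rV[R]_n) (u w c : 'rV[R]_n).

Definition convex_comb N C : set 'rV[R]_n :=
  [set u | exists (a : 'I_N -> R) (x : 'I_N -> 'rV[R]_n),
     [/\ forall i, 0 <= a i, \sum_i a i = 1, forall i, C (x i)
       & u = \sum_i a i *: x i]].

(** Carathéodory's step: n + 2 points of R^n are affinely dependent, and moving
    the weights along a dependence until the first one vanishes drops a point. *)
Lemma caratheodory_step C : convex_comb n.+2 C `<=` convex_comb n.+1 C.
Proof.
move=> _ [a [x [a0 a1 Cx ->]]].
pose M : 'M[R]_(n.+2, n + 1) := \matrix_i pairv (x i) 1.
have [b /sub_kermxP bM b0] : exists2 b : 'rV_n.+2, (b <= kermx M)%MS & b != 0.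
  apply/rowV0Pn; rewrite kermx_eq0 /row_free; apply/eqP => Mn.
  by have := rank_leq_col M; rewrite Mn addn1 ltnn.
have bM0 : \sum_i b 0 i *: pairv (x i) 1 = 0.
  rewrite -[RHS]bM mulmx_sum_row; apply: eq_bigr => i _; congr (_ *: _).
  by apply/rowP => k; rewrite !mxE.
have bx : \sum_i b 0 i *: x i = 0.
  have := congr1 lsubmx bM0; rewrite linear_sum linear0 /= => H; rewrite -[RHS]H.
  by apply: eq_bigr => i _; rewrite linearZ /= row_mxKl.
have bs : \sum_i b 0 i = 0.
  have := congr1 (fun A => rsubmx A 0 0) bM0.
  rewrite linear_sum linear0 summxE mxE => H; rewrite -[RHS]H; apply: eq_bigr => i _.
  by rewrite linearZ /= row_mxKr !mxE /= mulr1.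
have [i0 bi0] : exists i, 0 < b 0 i.
  apply: contrapT => nb; have b_le0 i : 0 <= - b 0 i.
    by rewrite oppr_ge0 leNgt; apply/negP => bi; apply: nb; exists i.
  move/eqP: b0; apply; apply/rowP => i; rewrite mxE.
  have /eqP : \sum_i - b 0 i = 0 by rewrite sumrN bs oppr0.
  rewrite psumr_eq0 // => /allP /(_ i); rewrite mem_index_enum oppr_eq0.
  by move=> /(_ isT) /eqP.
have [k bk kmin] := @arg_minP _ _ _ i0 (fun i => 0 < b 0 i)
  (fun i => a i / b 0 i) bi0.
pose t := a k / b 0 k; have t0 : 0 <= t by rewrite divr_ge0 // ltW.
pose a' i := a i - t * b 0 i.
have a'k : a' k = 0 by rewrite /a' /t divfK ?subrr // gt_eqF.
have a'0 i : 0 <= a' i.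
  rewrite subr_ge0; have [bi|bi] := leP (b 0 i) 0.
    by apply: le_trans (a0 i); rewrite mulr_ge0_le0.
  by rewrite -ler_pdivlMr //; exact: kmin.
have a's : \sum_i a' i = 1.
  by rewrite sumrB a1 -mulr_sumr bs mulr0 subr0.
have a'x : \sum_i a' i *: x i = \sum_i a i *: x i.
  under eq_bigr do rewrite scalerBl -scalerA.
  by rewrite sumrB -scaler_sumr bx scaler0 subr0.
exists (fun i => a' (lift k i)), (fun i => x (lift k i)); split=> //.
  by rewrite -a's (bigD1_ord k) //= a'k add0r.
by rewrite -a'x [LHS](bigD1_ord k) //= a'k scale0r add0r.
Qed.

Lemma convex_comb_nearest N C u : compact C -> C !=set0 ->
  exists2 c, convex_comb N.+1 C c &
    forall c', convex_comb N.+1 C c' -> enorm (c - u) <= enorm (c' - u).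
Proof.
move=> cC [c0 Cc0].
pose P := prod_topology (fun _ : 'I_N.+1 => (R * 'rV[R]_n)%type).
pose D := [set X : P | forall i, (`[0, 1]%classic `*` C) (X i)].
pose W := [set X : P | \sum_i (X i).1 = 1].
have pc i : continuous (fun X : P => X i).
  exact: (@proj_continuous _ (fun _ : 'I_N.+1 => (R * 'rV[R]_n)%type) i).
have c1 i : continuous (fun X : P => (X i).1).
  by apply: (continuous_compose (pc i)) => X; exact: cvg_fst.
have c2 i : continuous (fun X : P => (X i).2).
  by apply: (continuous_compose (pc i)) => X; exact: cvg_snd.
have cD : compact (D `&` W).
  apply: compact_closedI.
    apply: (@tychonoff _ (fun _ : 'I_N.+1 => (R * 'rV[R]_n)%type)
      (fun _ => `[0, 1]%classic `*` C)) => i.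
    by apply: compact_setX => //; exact: segment_compact.
  apply: (@preimage_closed _ _ (fun X : P => \sum_i (X i).1) [set 1]).
    by move=> X _; apply: (@continuous_sum R P R^o).
  exact: closed_eq.
pose F (X : P) := enorm (\sum_i (X i).1 *: (X i).2 - u).
have cF : continuous F.
  apply: (@continuous_compose P 'rV[R]_n R (fun X : P => \sum_i (X i).1 *: (X i).2)
    (fun y => enorm (y - u))); last exact: enorm_continuous.
  apply: (@continuous_sum R P 'rV[R]_n) => i X.
  exact: (@cvgZ _ _ _ _ (nbhs_filter X) _ _ _ _ (c1 i X) (c2 i X)).
have [||X] := @compact_EVT_min P R F (D `&` W) _ cD.
- exists (fun i => (if i == ord0 then 1 else 0, c0)); split.
    by move=> i; split=> //=; rewrite in_itv /=; case: ifP; rewrite ?lexx ler01.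
  by rewrite /W /= -big_mkcond /= big_pred1_eq.
- exact: continuous_subspaceT.
rewrite inE => -[DX WX] Xmin; exists (\sum_i (X i).1 *: (X i).2).
  exists (fun i => (X i).1), (fun i => (X i).2); split=> // i.
    by have [] := DX i; rewrite /= in_itv /= => /andP[].
  by have [] := DX i.
move=> _ [a [x [a0 a1 Cx ->]]]; apply: (Xmin (fun i => (a i, x i))).
rewrite inE; split=> // i; split=> //=; rewrite in_itv /= a0 /=.
by rewrite -a1 (bigD1 i) //= lerDl sumr_ge0.
Qed.

(** If the nearest combination of n + 1 points of C were not u, then a point of
    C beyond u in the direction from it to u would give a nearer combination of
    n + 2 points, hence of n + 1 points. *)
Lemma co_of_support C u : compact C -> C !=set0 ->
  (forall w, w <> 0 -> exists2 c, C c & dotv u w <= dotv c w) -> co C u.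
Proof.
move=> cC C0 H; have [b Cb bmin] := @convex_comb_nearest n C u cC C0.
have [ub|/eqP ub] := eqVneq (u - b) 0.
  by rewrite (subr0_eq ub); exists n.+1; exact: Cb.
have [c Cc cw] := H _ ub; exfalso.
have pw : 0 < dotv (u - b) (u - b) by rewrite -enorm_sqr exprn_gt0 ?enorm_gt0.
have closer t : 0 < t -> t <= 1 ->
    dotv (u - b) (u - b) <= t * dotv (c - b) (c - b) / 2.
  move=> t0 t1; have [a [x [a0 a1 Cx bE]]] := Cb.
  have /caratheodory_step /bmin : convex_comb n.+2 C (b + t *: (c - b)).
    exists (fun i => if unlift ord0 i is Some k then (1 - t) * a k else t).
    exists (fun i => if unlift ord0 i is Some k then x k else c); split.
    - by move=> i; case: unliftP => [k _|_]; rewrite ?mulr_ge0 ?subr_ge0 // ltW.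
    - rewrite big_ord_recl unlift_none; under eq_bigr do rewrite liftK.
      by rewrite -mulr_sumr a1 mulr1 addrC subrK.
    - by move=> i; case: unliftP.
    - rewrite big_ord_recl unlift_none; under [in RHS]eq_bigr do rewrite liftK -scalerA.
      rewrite -scaler_sumr -bE scalerBr scalerBl scale1r.
      by rewrite [b + _]addrCA.
  rewrite enormB [leRHS]enormB -(@ler_pXn2r _ 2) ?nnegrE ?enorm_ge0 // !enorm_sqr.
  have -> : u - (b + t *: (c - b)) = (u - b) - t *: (c - b) by rewrite opprD addrA.
  have : dotv (u - b) (u - b) <= dotv (c - b) (u - b).
    by rewrite (dotvDl u) (dotvDl c) lerD2r.
  move: (u - b) (c - b) => w v wv; rewrite !dotvE (dotvC w v) => Ht.
  rewrite -(ler_pM2l t0); have := ler_wpM2l (ltW t0) wv; lra.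
have : dotv (u - b) (u - b) <= 0; last by rewrite leNgt pw.
apply: (@le0_of_small _ _ (dotv (c - b) (c - b) / 2) 1 ltr01) => t t0 t1.
by rewrite mulrA; exact: closer.
Qed.

Lemma co_mono C D : C `<=` D -> co C `<=` co D.
Proof.
by move=> CD u [k [a [x [a0 a1 Cx ->]]]]; exists k, a, x; split=> // i; exact: CD.
Qed.

End ConvexHull.

(** * The maximum rule *)

(** In every direction some bounded active subgradient does as well as u, and
    these form a compact set, so u lies in their convex hull. *)
Lemma gmax_subgrad (R : realType) n p (q : 'I_p -> nat)
    (V : forall j : 'I_p, set 'rV[R]_(q j))
    (g : forall j : 'I_p, 'rV[R]_n -> 'rV[R]_(q j) -> R) (j : 'I_p) z u :
  V j !=set0 -> compact (V j) -> constraint_conditions V g ->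
  prox_limsub (gmax V g j) z u ->
  co (\bigcup_(v in active V g j z) limsub (fun x => g j x v) z) u.
Proof.
move=> V0 cV cond zu.
have [d [K [d0 K0 gK GK]]] := constraint_lipschitz V0 cV cond z.
have sub : bounded_active_subgrad V g j z K `<=`
    \bigcup_(v in active V g j z) limsub (fun x => g j x v) z.
  by move=> c [_ [v av cv]]; exists v.
apply: (co_mono sub); apply: co_of_support.
- exact: (bounded_active_subgrad_compact V0 cV cond).
- exact: (bounded_active_subgrad_nonempty V0 cV cond d0 K0 gK).
- by move=> w w0; exact: (max_subgrad_direction V0 cV cond d0 K0 gK GK zu w0).
Qed.

(** A zero multiplier must still scale a nonempty set to contribute 0. *)
Lemma active_hull_nonempty (R : realType) n p (q : 'I_p -> nat)
    (V : forall j : 'I_p, set 'rV[R]_(q j))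
    (g : forall j : 'I_p, 'rV[R]_n -> 'rV[R]_(q j) -> R) (j : 'I_p) z :
  V j !=set0 -> compact (V j) -> constraint_conditions V g ->
  co (\bigcup_(v in active V g j z) limsub (fun x => g j x v) z) !=set0.
Proof.
move=> V0 cV cond; have GL := gmax_locally_lipschitz V0 cV cond.
by have [u zu] := prox_limsub_nonempty z GL; exists u; exact: gmax_subgrad.
Qed.

(** * The squared penalty of a constraint *)

Section Penalty.
Context {R : realType} {n : nat}.
Implicit Types (G : 'rV[R]_n -> R) (x y z u : 'rV[R]_n).

Definition penalty (r : R) G x : R := r * Num.max (G x) 0 ^+ 2.

Lemma max0_dist (a b : R) : `|Num.max a 0 - Num.max b 0| <= `|a - b|.
Proof.
by have [a0|a0] := leP a 0; have [b0|b0] := leP b 0;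
  rewrite ler_norml; apply/andP; split;
  have := ler_norm (a - b); have := ler_norm (b - a); rewrite (distrC b a); lra.
Qed.

(** The square r s^2 has slope 2 r s, and s = max (G x) 0 stays below
    max (G z) 0 + K d on the ball. *)
Lemma penalty_lipschitz r G z (d K : R) : 0 <= r -> 0 <= K ->
  lipschitz_with K (eball z d) G ->
  lipschitz_with (r * (2 * (Num.max (G z) 0 + K * d)) * K) (eball z d) (penalty r G).
Proof.
move=> r0 K0 GK x y xz yz; have m0 w : 0 <= Num.max (G w) 0 by rewrite le_max lexx orbT.
have bnd w : eball z d w -> Num.max (G w) 0 <= Num.max (G z) 0 + K * d.
  move=> wz; have zz : eball z d z.
    by rewrite /eball /= subrr enorm0; exact: le_lt_trans (enorm_ge0 _) wz.
  have /ler_normlP [_ +] := le_trans (max0_dist (G w) (G z)) (GK _ _ wz zz).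
  have := ler_wpM2l K0 (ltW wz); lra.
rewrite /penalty -mulrBr subr_sqr normrM ger0_norm // normrM -!mulrA.
apply: ler_wpM2l => //; rewrite mulrC mulrA ler_pM //.
  rewrite ger0_norm ?addr_ge0 //.
  by have := bnd _ xz; have := bnd _ yz; lra.
exact: le_trans (max0_dist _ _) (GK _ _ xz yz).
Qed.

Lemma penalty_locally_lipschitz r G : 0 <= r -> locally_lipschitz G ->
  locally_lipschitz (penalty r G).
Proof.
move=> r0 GL z; have [d d0 [K0 /lipschitz_with_pos [K K1 GK]]] := GL z.
exists d => //; exists (r * (2 * (Num.max (G z) 0 + K * d)) * K).
exact: penalty_lipschitz (ltW K1) GK.
Qed.

(** Where the constraint holds, the Lipschitz constants of the penalty on small
    balls tend to zero. *)
Lemma penalty_subgrad_eq0 r G z u : 0 <= r -> locally_lipschitz G ->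
  G z <= 0 -> prox_limsub (penalty r G) z u -> u = 0.
Proof.
move=> r0 GL Gz zu; have [d d0 [K0 /lipschitz_with_pos [K K1 GK]]] := GL z.
apply: enorm_eq0; apply/eqP; rewrite eq_le enorm_ge0 andbT.
apply: (@le0_of_small _ _ (r * 2 * K * K) d d0) => t t0 td.
have GKt : lipschitz_with K (eball z t) G.
  have sub y : eball z t y -> eball z d y by move/lt_le_trans; exact.
  by move=> x y /sub xz /sub yz; exact: GK.
have := penalty_lipschitz r0 (ltW K1) GKt; rewrite max_r // add0r.
have -> : r * (2 * (K * t)) * K = t * (r * 2 * K * K) by ring.
move=> H; apply: (prox_limsub_lipschitz t0 _ H zu).
by rewrite !mulr_ge0 ?(ltW t0) ?(ltW K1).
Qed.

(** Where G > 0 the penalty is r G^2, whose increments are 2 r G times those of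
    G up to a quadratic error. *)
Lemma penalty_subgrad r G z u : 0 < r -> locally_lipschitz G ->
  0 < G z -> prox_limsub (penalty r G) z u ->
  prox_limsub G z ((2 * r * G z)^-1 *: u).
Proof.
move=> r0 GL Gz zu e e0; have Gc := locally_lipschitz_continuous GL.
have [d d0 [K0 /lipschitz_with_pos [K K1 GK]]] := GL z.
pose mu x := (2 * r * G x)^-1; have muz : 0 < mu z by rewrite invr_gt0 !mulr_gt0.
pose eta := e / 2 / (enorm u + 1).
have eta0 : 0 < eta by rewrite !divr_gt0 // ltr_wpDl ?enorm_ge0.
have [d1 d10 Gpos] : exists2 d1 : R, 0 < d1 &
    forall x, enorm (x - z) < d1 -> 0 < G x.
  apply/nbhs_enormP; apply: (Gc z [set a : R | 0 < a]).
  by apply: open_nbhs_nbhs; split => //; exact: open_gt.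
have [d2 d20 mud] : exists2 d2 : R, 0 < d2 &
    forall x, enorm (x - z) < d2 -> `|mu z - mu x| < Num.min 1 eta.
  have m0 : 0 < Num.min 1 eta by rewrite lt_min ltr01.
  apply/nbhs_enormP; have muc : mu x @[x --> z] --> mu z.
    apply: (@cvgV _ _ _ (nbhs_filter z)); first by rewrite gt_eqF // !mulr_gt0.
    exact: (@cvgM _ _ _ (nbhs_filter z) _ _ _ _ (cvg_cst _) (Gc z)).
  exact: muc (nbhsx_ballx (mu z) _ m0).
(* s keeps x in the ball where G is Lipschitz and positive, with room for y,
   and makes both mu x - mu z and v - u small *)
pose s := Num.min (Num.min (d / 2) (d1 / 2)) (Num.min d2 (Num.min e (e / 2 / (mu z + 1)))).
have [|x [v [xz vu [k [q [k0 q0 H]]]]]] := zu s.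
  by rewrite !lt_min e0 d20 !divr_gt0 // addr_gt0.
move: xz; rewrite !lt_min => /andP[/andP[xd xd1] /andP[/mud xd2 /andP[xe _]]].
move: vu; rewrite !lt_min => /andP[_ /and3P[_ _ vu]].
move: xd2; rewrite lt_min => /andP[mu1 mueta].
have Gx : 0 < G x by apply: Gpos; apply: lt_le_trans xd1 _; lra.
have mux : 0 < mu x by rewrite invr_gt0 !mulr_gt0.
have mux1 : mu x < mu z + 1 by move: mu1; rewrite distrC => /ltr_normlP [_]; lra.
exists x, (mu x *: v); split=> //.
  have -> : mu x *: v - mu z *: u = mu x *: (v - u) + (mu x - mu z) *: u.
    by rewrite scalerBr scalerBl addrA subrK.
  apply: le_lt_trans (enormD _ _) _; rewrite !enormZ gtr0_norm // distrC.
  rewrite [ltRHS](splitr e) ltr_leD //.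
    apply: (@le_lt_trans _ _ ((mu z + 1) * enorm (v - u))).
      by apply: ler_wpM2r; [exact: enorm_ge0|exact: ltW].
    by rewrite mulrC -ltr_pdivlMr // addr_gt0.
  apply: (@le_trans _ _ (eta * (enorm u + 1))); last first.
    by rewrite /eta divfK // gt_eqF // ltr_wpDl ?enorm_ge0.
  by apply: ler_pM; rewrite ?enorm_ge0 // ?lerDl // ltW.
exists (mu x * (k + r * K ^+ 2)), (Num.min q (Num.min (d / 2) (d1 / 2))); split.
- by rewrite mulr_gt0 // ltr_pwDl // mulr_ge0 ?exprn_ge0 // ltW.
- by rewrite !lt_min q0 !divr_gt0.
move=> y; rewrite !lt_min => /and3P[yq yd yd1].
have Gy : 0 < G y.
  by apply: Gpos; have := enorm_lt_ball yd1 (ltW xd1); rewrite -splitr.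
have yz : eball z d y by have := enorm_lt_ball yd (ltW xd); rewrite -splitr.
have xz : eball z d x by rewrite /eball /=; apply: lt_le_trans xd _; lra.
have := H y yq; rewrite /penalty !max_l ?(ltW Gx) ?(ltW Gy) //.
have : (G y - G x) ^+ 2 <= K ^+ 2 * dotv (y - x) (y - x).
  rewrite -enorm_sqr -exprMn -real_normK ?num_real //.
  by rewrite ler_pXn2r ?nnegrE ?mulr_ge0 ?enorm_ge0 ?(ltW K1) // GK.
rewrite -(ler_pM2l r0) dotvZl => Gsq Hy.
have muE : mu x * (2 * r * G x) = 1 by rewrite mulVf // gt_eqF // !mulr_gt0.
have : dotv v (y - x) - (k + r * K ^+ 2) * dotv (y - x) (y - x) <=
    (2 * r * G x) * (G y - G x) by lra.
rewrite -(ler_pM2l mux) [leRHS]mulrA muE; lra.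
Qed.

End Penalty.

(** * An approximate minimizer that minimizes a perturbed function *)

(** Ekeland's principle; in finite dimension one minimization suffices, of F plus
    a cone centred at a theta-minimizer x0. *)
Lemma approximate_minimizer (R : realType) n (S : set 'rV[R]_n)
    (F : 'rV[R]_n -> R) (th : R) :
  S !=set0 -> closed S -> continuous F -> has_lbound [set F x | x in S] -> 0 < th ->
  exists z, [/\ S z, forall x, S x -> F z <= F x + th
    & forall x, S x -> F z <= F x + Num.sqrt th * enorm (x - z)].
Proof.
move=> S0 clS cF lbF th0; pose W := [set F x | x in S].
have infW : has_inf W by split=> //; have [x Sx] := S0; exists (F x), x.
have [_ [x0 Sx0 <-] x0inf] := inf_adherent th0 infW.
have infle x : S x -> inf W <= F x by move=> Sx; apply: ge_inf => //; exists x.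
have r0 : 0 < Num.sqrt th by rewrite sqrtr_gt0.
pose B := [set y | enorm (y - x0) <= Num.sqrt th] `&` S.
have cB : compact B by apply: compact_closedI clS; exact: compact_enorm_le.
pose H x := F x + Num.sqrt th * enorm (x - x0).
have cH : continuous H.
  move=> x; apply: (@cvgD _ R^o _ _ (nbhs_filter x)); first exact: cF.
  exact: (@cvgM _ _ _ (nbhs_filter x) _ _ _ _ (cvg_cst _) (@enorm_continuous _ _ x0 x)).
have [||z] := @compact_EVT_min _ R H B _ cB.
- by exists x0; split=> //=; rewrite subrr enorm0 ltW.
- exact: continuous_subspaceT.
rewrite inE => -[zx0 Sz] zmin.
have Hz0 : H z <= F x0.
  apply: le_trans (zmin x0 _) _; last by rewrite /H subrr enorm0 mulr0 addr0.
  by rewrite inE; split=> //=; rewrite subrr enorm0 ltW.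
have Hz x : S x -> H z <= H x.
  move=> Sx; have [xr|xr] := leP (enorm (x - x0)) (Num.sqrt th).
    by apply: zmin; rewrite inE.
  apply: le_trans Hz0 _; apply: (le_trans (ltW x0inf)).
  apply: lerD; first exact: infle.
  by rewrite -[leLHS]sqr_sqrtr ?(ltW th0) // expr2 ler_pM2l // ltW.
have e0 := mulr_ge0 (ltW r0) (enorm_ge0 (z - x0)).
exists z; split=> // x Sx.
  by have := infle x Sx; move: Hz0; rewrite /H; lra.
have := Hz x Sx; rewrite /H.
by have := ler_wpM2l (ltW r0) (enorm_triangle z x x0); lra.
Qed.

Lemma dominates_sum (R : realType) m (A B : 'I_m -> ival R) : dominates A B ->
  \sum_i (lo (A i) + hi (A i)) < \sum_i (lo (B i) + hi (B i)).
Proof.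
move=> [AB [k [[kl kh] kn]]]; rewrite (bigD1 k) //= [ltRHS](bigD1 k) //=.
apply: ltr_leD; last by apply: ler_sum => i _; have [? ?] := AB i; rewrite lerD.
move: kl; rewrite le_eqVlt => /predU1P[kl|kl]; last by rewrite ltr_leD.
move: kh; rewrite le_eqVlt => /predU1P[kh|kh]; last by rewrite ler_ltD // kl.
by case: kn; case: (A k) (B k) kl kh => [? ?] [? ?] /= -> ->.
Qed.

(** * Almost regular Pareto solutions and multipliers *)

Theorem theorem3p2 (R : realType) (n m p : nat) (q : 'I_p -> nat)
    (S : set 'rV[R]_n)
    (f : 'I_m -> 'rV[R]_n -> ival R)
    (V : forall j : 'I_p, set 'rV[R]_(q j))
    (g : forall j : 'I_p, 'rV[R]_n -> 'rV[R]_(q j) -> R)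
    (E : 'I_m -> ival R) :
  S !=set0 -> closed S ->
  (forall i x, Kc (f i x)) ->
  (forall i, locally_lipschitz (fun x => lo (f i x))) ->
  (forall i, locally_lipschitz (fun x => hi (f i x))) ->
  (forall j, V j !=set0) -> (forall j, compact (V j)) ->
  constraint_conditions V g ->
  (forall i, 0 <= lo (E i) /\ lo (E i) <= hi (E i)) ->
  0 < theta E ->
  Omega S V g !=set0 ->
  has_lbound [set \sum_(i < m) (lo (f i x) + hi (f i x)) | x in S] ->
  exists (z : 'rV[R]_n) (lam : 'I_p -> R),
    [/\ almost_regular_pareto S f V g E z,
        forall j, 0 <= lam j,
        mink_sum (mink_bigsum (fun i => mink_sum (limsub (fun x => lo (f i x)) z)
                                     (limsub (fun x => hi (f i x)) z)))
          (mink_sum (mink_bigsum (fun j => mink_scale (lam j)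
                   (co (\bigcup_(v in active V g j z)
                          limsub (fun x => g j x v) z))))
            (mink_sum (normal_cone z S)
                  (mink_scale (Num.sqrt (theta E)) closed_unit_ball))) 0,
        forall j, 0 < gmax V g j z /\ gmax V g j z <= Num.sqrt (theta E) -> 0 < lam j
      & forall j, gmax V g j z <= 0 -> lam j = 0].
Proof.
move=> S0 clS _ loL hiL V0 cV cond _ th0 [xf [Sxf xfV]] [al al_lb].
pose th := theta E; pose phi x := \sum_(i < m) (lo (f i x) + hi (f i x)).
have phi_lb x : S x -> al <= phi x by move=> Sx; apply: al_lb; exists x.
have GL j : locally_lipschitz (gmax V g j) by exact: gmax_locally_lipschitz.
have G_feasible x : Omega S V g x -> forall j, gmax V g j x <= 0.
  move=> [_ xV] j; have [v [Vv <-]] := active_nonempty (V0 j) (cV j) cond x.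
  exact: xV.
(* large enough for a theta-minimizer to violate no constraint by more than
   the square root of theta *)
have [r r0 rth] : exists2 r, 0 < r & r * th = phi xf + th - al.
  exists ((phi xf + th - al) / th); last by rewrite divfK // gt_eqF.
  by rewrite divr_gt0 //; have := phi_lb _ Sxf; rewrite /th; lra.
pose Psi x := phi x + \sum_j penalty r (gmax V g j) x.
have pen0 j x : 0 <= penalty r (gmax V g j) x.
  by rewrite mulr_ge0 ?sqr_ge0 // ltW.
have penS0 x : 0 <= \sum_j penalty r (gmax V g j) x by rewrite sumr_ge0.
have PsiO x : Omega S V g x -> Psi x = phi x.
  move=> Ox; rewrite /Psi big1 ?addr0 // => j _.
  by rewrite /penalty max_r ?G_feasible // expr0n mulr0.
have cPsi : continuous Psi.
  apply: (@continuous_add R _ R^o).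
    apply: (@continuous_sum R _ R^o) => i; apply: (@continuous_add R _ R^o).
      exact/locally_lipschitz_continuous.
    exact/locally_lipschitz_continuous.
  apply: (@continuous_sum R _ R^o) => j; apply: locally_lipschitz_continuous.
  by apply: penalty_locally_lipschitz => //; exact: ltW.
have [|z [Sz z_min z_pert]] := approximate_minimizer S0 clS cPsi _ th0.
  by exists al => _ [x Sx <-]; rewrite ler_wpDr // phi_lb.
rewrite -/th in z_min z_pert; have sth0 : 0 < Num.sqrt th by rewrite sqrtr_gt0.
have phiPsi : phi z <= Psi z by rewrite lerDl.
have Gz j : gmax V g j z <= Num.sqrt th.
  have pth : penalty r (gmax V g j) z <= r * th.
    have : penalty r (gmax V g j) z <= \sum_j penalty r (gmax V g j) z.
      by rewrite (bigD1 j) //= lerDl sumr_ge0.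
    rewrite rth; by have := z_min xf Sxf; have := phi_lb z Sz; rewrite (PsiO xf) // /Psi; lra.
  apply: (@le_trans _ _ (Num.max (gmax V g j z) 0)); first by rewrite le_max lexx.
  rewrite -(@ler_pXn2r _ 2) ?nnegrE ?le_max ?lexx ?orbT ?(ltW sth0) //.
  by rewrite sqr_sqrtr ?(ltW th0) // -(ler_pM2l r0).
have OEz : OmegaE S V g E z by split.
pose T : finType := (('I_m + 'I_m) + ('I_p + unit))%type.
pose h (t : T) : 'rV[R]_n -> R := match t with
  | inl (inl i) => fun x => lo (f i x)
  | inl (inr i) => fun x => hi (f i x)
  | inr (inl j) => penalty r (gmax V g j)
  | inr (inr _) => fun x => Num.sqrt th * enorm (x - z)
  end.
have coneL K A : lipschitz_with K A (fun x => enorm (x - z)) ->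
    lipschitz_with (Num.sqrt th * K) A (h (inr (inr tt))).
  move=> KA x y Ax Ay; rewrite /h /= -mulrBr normrM (gtr0_norm sth0) -mulrA.
  by rewrite ler_pM2l // KA.
have hL t : locally_lipschitz (h t).
  case: t => [[i|i]|[j|[]]]; [exact: loL|exact: hiL| |].
    exact: (penalty_locally_lipschitz (ltW r0) (GL j)).
  move=> x; have [d d0 [K KA]] := enorm_locally_lipschitz z x.
  by exists d => //; exists (Num.sqrt th * K); exact: coneL.
have sum_h x : \sum_t h t x = Psi x + Num.sqrt th * enorm (x - z).
  rewrite !big_sumType /= (big_pred1 tt) /=; last by case.
  by rewrite addrA -big_split.
have zmin x : S x -> \sum_t h t z <= \sum_t h t x.
  by move=> Sx; rewrite !sum_h subrr enorm0 mulr0 addr0 z_pert.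
have [u hu nu] := sum_rule clS Sz hL zmin.
have lim_h t : prox_limsub (h t) z (u t) -> limsub (h t) z (u t).
  by apply: prox_limsub_sub; exact: locally_lipschitz_continuous.
pose lam j := 2 * r * Num.max (gmax V g j z) 0.
exists z, lam; split.
- split; split=> // -[x [Ox /dominates_sum]]; have Sx : S x by have [] := Ox.
    rewrite (_ : \sum_i (lo (isub _ _) + _) = phi z - th) => [xz|].
      by have := z_min x Sx; rewrite (PsiO x) //; move: xz; rewrite -/(phi x); lra.
    by rewrite /phi /th /theta -sumrB; apply: eq_bigr => i _ /=; ring.
  rewrite (_ : \sum_i (lo (isub _ _) + _) = phi z - Num.sqrt th * enorm (x - z)) => [xz|].
    by have := z_pert x Sx; rewrite (PsiO x) //; move: xz; rewrite -/(phi x); lra.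
  have -> : Num.sqrt th * enorm (x - z) = enorm (x - z) * ((Num.sqrt th)^-1 * th).
    have sE : Num.sqrt th * Num.sqrt th = th by rewrite -expr2 sqr_sqrtr // ltW.
    by rewrite -[X in _^-1 * X]sE mulKf ?gt_eqF // mulrC.
  rewrite /phi /th [X in _ * (_^-1 * X)]/theta !mulr_sumr -sumrB.
  by apply: eq_bigr => i _ /=; ring.
- move=> j; apply: mulr_ge0; last by rewrite le_max lexx orbT.
  by apply: mulr_ge0 => //; exact: ltW.
- exists (\sum_i (u (inl (inl i)) + u (inl (inr i)))).
  exists (\sum_j u (inr (inl j)) + (- \sum_t u t + u (inr (inr tt)))); split.
  + exists (fun i => u (inl (inl i)) + u (inl (inr i))); split=> // i.
    exists (u (inl (inl i))), (u (inl (inr i))).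
    by split=> //; [exact: (lim_h (inl (inl i)))|exact: (lim_h (inl (inr i)))].
  + exists (\sum_j u (inr (inl j))), (- \sum_t u t + u (inr (inr tt))).
    split=> //.
      exists (fun j => u (inr (inl j))); split=> // j.
      have uj : prox_limsub (penalty r (gmax V g j)) z (u (inr (inl j))).
        exact: (hu (inr (inl j))).
      have [Gj|Gj] := leP (gmax V g j z) 0.
        have [c cz] := active_hull_nonempty z (V0 j) (cV j) cond.
        exists c => //; rewrite /lam max_r // mulr0 scale0r.
        by rewrite (penalty_subgrad_eq0 (ltW r0) (GL j) Gj uj).
      exists ((2 * r * gmax V g j z)^-1 *: u (inr (inl j))).
        by apply: gmax_subgrad => //; exact: penalty_subgrad.
      have l0 : 0 < 2 * r * gmax V g j z by rewrite !mulr_gt0.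
      by rewrite /lam max_l ?(ltW Gj) // scalerA divff ?scale1r // gt_eqF.
    exists (- \sum_t u t), (u (inr (inr tt))); split=> //.
      exact: prox_limnormal_sub.
    exists ((Num.sqrt th)^-1 *: u (inr (inr tt))).
      rewrite /closed_unit_ball /= enormZ gtr0_norm ?invr_gt0 // mulrC.
      rewrite ler_pdivrMr // mul1r.
      apply: (@prox_limsub_lipschitz _ _ (h (inr (inr tt))) z _ 1) => //.
      rewrite -[X in lipschitz_with X]mulr1; apply: coneL => x y _ _.
      by rewrite mul1r enorm_lipschitz.
    by rewrite scalerA divff ?scale1r // gt_eqF.
  + rewrite !big_sumType /= (big_pred1 tt) /=; last by case.
    by rewrite big_split /= (addrC (- _)) !addrA subrr.
- by move=> j [Gj _]; rewrite /lam max_l ?(ltW Gj) // !mulr_gt0.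
- by move=> j Gj; rewrite /lam max_r // mulr0.
Qed.
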